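(* For any $\epsilon\in(0,1)$, there is a randomized $\mathsf{Broadcast}$ algorithm in the $\mathsf{No}\text{-}\mathsf{CD}$ model that, on any $n$-vertex network of diameter $D$, takes $O(D^{1+\epsilon}\log^{O(1/\epsilon)}n)$ time, uses $O(\log^{O(1/\epsilon)}n)$ energy, and succeeds with high probability.
   Context: Radio network model: connected undirected graph with $n$ vertices and diameter $D$ (parameters known to the vertices, topology unknown); synchronized slots; each vertex transmits, listens or idles per slot; transmit/listen cost one unit of energy; energy = maximum per-vertex number of transmit/listen slots. $\mathsf{No}\text{-}\mathsf{CD}$: a listener receives a message iff exactly one neighbor transmits; otherwise silence. Randomized algorithms use private random bits; ''with high probability'' = failure probability $\le1/\mathrm{poly}(n)$. $\mathsf{Broadcast}$: a source vertex holds a message that all vertices must learn. *)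

(* Defs.v *)
From mathcomp Require Import all_boot.
From Stdlib Require Import Reals.
Set Implicit Arguments. Unset Strict Implicit. Unset Printing Implicit Defensive.

Definition simple_graph n (adj : rel 'I_n) : Prop :=
  (forall u v, adj u v = adj v u) /\ (forall u, ~~ adj u u).

Fixpoint within n (adj : rel 'I_n) (k : nat) (u v : 'I_n) : bool :=
  match k with
  | 0 => u == v
  | k'.+1 => within adj k' u v || [exists w, within adj k' u w && adj w v]
  end.

Definition has_diameter n (adj : rel 'I_n) (D : nat) : Prop :=
  (forall u v, within adj D u v) /\
  (D > 0 -> exists u v, ~~ within adj D.-1 u v).

Inductive action := Idle | Listen | Transmit of nat.

Definition msg_of (a : action) : option nat :=
  if a is Transmit x then Some x else None.
Definition is_transmit (a : action) : bool :=
  if a is Transmit _ then true else false.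
Definition is_active (a : action) : bool :=
  if a is Idle then false else true.

(* A (anonymous) randomized algorithm, for fixed known parameters n and D:
   - every vertex has a private random tape of [rbits] bits;
   - it runs for [rounds] synchronized slots;
   - [act inp r h] is the action in the next slot of a vertex with input [inp]
     (Some m for the source holding message m, None otherwise), random tape
     [r] and local history [h] (one entry per past slot: Some x if it
     listened and received x, None otherwise);
   - [output inp r h] is the message the vertex outputs at the end. *)
Record algorithm := Algorithm {
  rbits : nat;
  rounds : nat;
  act : option nat -> rbits.-tuple bool -> seq (option nat) -> action;
  output : option nat -> rbits.-tuple bool -> seq (option nat) -> nat }.

Definition tapes (A : algorithm) (n : nat) := {ffun 'I_n -> (rbits A).-tuple bool}.

Definition input n (s : 'I_n) (m : nat) (v : 'I_n) : option nat :=
  if v == s then Some m else None.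

Section Exec.
Variables (A : algorithm) (n : nat) (adj : rel 'I_n) (s : 'I_n) (m : nat)
          (r : tapes A n).

Definition act_of (h : 'I_n -> seq (option nat)) (u : 'I_n) : action :=
  @act A (input s m u) (r u) (h u).

Definition obs (h : 'I_n -> seq (option nat)) (v : 'I_n) : option nat :=
  match act_of h v with
  | Listen =>
      let X := [set u | adj v u && is_transmit (act_of h u)] in
      if #|X| == 1 then
        match [pick u in X] with Some u => msg_of (act_of h u) | None => None end
      else None
  | _ => None
  end.

Fixpoint hist (t : nat) : 'I_n -> seq (option nat) :=
  match t with
  | 0 => fun _ => [::]
  | t'.+1 => let h := hist t' in fun v => rcons (h v) (obs h v)
  end.

Definition energy_of (v : 'I_n) : nat :=
  #|[set t : 'I_(rounds A) | is_active (act_of (hist t) v)]|.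

Definition broadcast_ok : bool :=
  [forall v, @output A (input s m v) (r v) (hist (rounds A) v) == m].
End Exec.

Definition fail_prob (A : algorithm) n (adj : rel 'I_n) (s : 'I_n) (m : nat) : R :=
  (INR #|[set r : tapes A n | ~~ broadcast_ok adj s m r]| /
   INR #|[set: tapes A n]|)%R.

(* Main.v *)
(** Fix L ~ log n and b = polylog n. Level i keeps O(L) labelings of the
    vertices such that a positive label k has a neighbour labelled k - 1. In a
    cast along a labeling the layers speak one after the other, from the last one
    down to 0 and up again, so that a vertex is awake in O(1) steps; information
    travels between any two vertices lying above a common root. The invariant is
    that any two vertices at distance at most b^i lie above a common root in one
    of the labelings of level i, so that one phase (a cast along each of them)
    crosses distance b^i. At level i + 1, every labeling comes from a wave in the
    style of Miller, Peng and Xu: vertex u starts at a phase equal to 2b + 1 times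
    a truncated geometric variable, the wave spreads by phases of level i, and a
    vertex is labelled by the number of hops of the first message it receives. With
    probability at least 1/4, one vertex u is ahead of all others by 2b + 1 phases
    at a given v; then all vertices within distance b^(i+1) of v hang from u.
    Once b^q >= D a single phase of level q broadcasts. The number of slots grows
    by a factor b polylog n per level, where the polylog n is at most b^eps, and
    the energy only adds up over the levels. *)

Require Import Defs.
From mathcomp Require Import all_boot zify.
From Stdlib Require Import Reals Lra FunctionalExtensionality.
Import ssrnat.
Set Implicit Arguments. Unset Strict Implicit. Unset Printing Implicit Defensive.

(** * Counting over independent coordinates *)

Section Resampling.
Variables (I B : finType).
Implicit Types (f : {ffun I -> B}) (i : I) (c : B).

Definition upd f i c : {ffun I -> B} := [ffun x => if x == i then c else f x].

Lemma updE f i c x : upd f i c x = if x == i then c else f x.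
Proof. by rewrite ffunE. Qed.

Lemma upd_upd f i c d : upd (upd f i c) i d = upd f i d.
Proof. by apply/ffunP=> x; rewrite !ffunE; case: eqP. Qed.

Lemma upd_id f i : upd f i (f i) = f.
Proof. by apply/ffunP=> x; rewrite !ffunE; case: eqP => [->|]. Qed.

(** The map sending [(f, c)] to [(upd f i c, f i)] is an involution of the pairs, so resampling
    coordinate [i] reaches every function equally often. *)
Lemma sum_upd (F : {ffun I -> B} -> nat) i :
  \sum_f \sum_c F (upd f i c) = #|B| * \sum_f F f.
Proof.
have -> : #|B| * \sum_f F f = \sum_f \sum_(c : B) F f.
  by rewrite big_distrr /=; apply: eq_bigr => f _; rewrite sum_nat_const.
rewrite !pair_bigA /=.
rewrite [RHS](reindex (fun p : {ffun I -> B} * B => (upd p.1 i p.2, p.1 i))) //=.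
exists (fun p : {ffun I -> B} * B => (upd p.1 i p.2, p.1 i)) => -[f c] _ /=;
  by rewrite upd_upd upd_id updE eqxx.
Qed.

(* Fubini over coordinate [i], which neither [X] nor [bad] looks at. *)
Lemma card_resample (X : pred {ffun I -> B}) (bad : {ffun I -> B} -> {set B}) i :
  (forall f c, X (upd f i c) = X f) ->
  (forall f c, bad (upd f i c) = bad f) ->
  #|[set f : {ffun I -> B} | X f & f i \in bad f]| * #|B| = \sum_(f | X f) #|bad f|.
Proof.
move=> hX hbad; rewrite -sum1_card big_mkcond /= mulnC -(@sum_upd _ i) [RHS]big_mkcond /=.
apply: eq_bigr => f _.
transitivity (\sum_(c : B) (if X f && (c \in bad f) then 1 else 0)).
  by apply: eq_bigr => c _; rewrite inE hX hbad updE eqxx.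
case: (X f) => /=; last by rewrite big1.
by rewrite -big_mkcond sum1_card.
Qed.

Lemma card_resample_const (X : pred {ffun I -> B}) (A : {set B}) i :
  (forall f c, X (upd f i c) = X f) ->
  #|[set f : {ffun I -> B} | X f & f i \in A]| * #|B| = #|X| * #|A|.
Proof.
by move=> hX; rewrite (@card_resample X (fun=> A)) // sum_nat_const.
Qed.

Lemma card_resample_le (X : pred {ffun I -> B}) (bad : {ffun I -> B} -> {set B}) i a d :
  (forall f c, X (upd f i c) = X f) ->
  (forall f c, bad (upd f i c) = bad f) ->
  (forall f, d * #|bad f| <= a * #|B|) ->
  d * #|[set f : {ffun I -> B} | X f & f i \in bad f]| <= a * #|X|.
Proof.
move=> hX hbad hle.
have [B0|Bpos] := posnP #|B|.
  suff -> : #|[set f : {ffun I -> B} | X f & f i \in bad f]| = 0 by rewrite muln0.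
  apply: eq_card0 => f; have := max_card (pred1 (f i)).
  by rewrite card1 B0.
rewrite -(leq_pmul2r Bpos) -mulnA card_resample // big_distrr /=.
apply: leq_trans (leq_sum _ (fun f _ => hle f)) _.
by rewrite sum_nat_const mulnCA mulnA leqnn.
Qed.

(** Independence by induction on [k]. No bad set looks at any of the coordinates [e j], so
    conditionally on the others each one is bad with probability at most [a / d]. *)
Lemma card_resample_family k (e : 'I_k -> I) (bad : 'I_k -> {ffun I -> B} -> {set B}) a d :
  injective e ->
  (forall j j' f c, bad j (upd f (e j') c) = bad j f) ->
  (forall j f, d * #|bad j f| <= a * #|B|) ->
  d ^ k * #|[set f : {ffun I -> B} | [forall j, f (e j) \in bad j f]]| <= a ^ k * #|{ffun I -> B}|.
Proof.
elim: k e bad => [|k IH] e bad inj_e hbad hle.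
  by rewrite !expn0 !mul1n max_card.
pose e' (j : 'I_k) := e (lift ord0 j).
pose bad' (j : 'I_k) := bad (lift ord0 j).
have inj_e' : injective e' by move=> x y /inj_e /lift_inj.
have IH' := IH e' bad' inj_e' (fun j j' => hbad _ _) (fun j => hle _).
pose X : pred {ffun I -> B} := fun f => [forall j, f (e' j) \in bad' j f].
have hX f c : X (upd f (e ord0) c) = X f.
  apply: eq_forallb => j; rewrite /bad' hbad updE.
  by rewrite (inj_eq inj_e) eq_sym (negbTE (neq_lift _ _)).
have := card_resample_le hX (hbad ord0 ord0) (hle ord0).
have -> : [set f : {ffun I -> B} | X f & f (e ord0) \in bad ord0 f] =
          [set f : {ffun I -> B} | [forall j, f (e j) \in bad j f]].
  apply/setP=> f; rewrite !inE; apply/andP/forallP => [[/forallP Xf f0] j|h].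
    by case: (unliftP ord0 j) => [j' ->|-> //]; apply: (Xf j').
  by split; [apply/forallP => j; apply: h | apply: h].
move=> h; rewrite expnSr -mulnA.
apply: leq_trans (leq_mul (leqnn _) h) _.
rewrite mulnCA expnS -mulnA leq_mul2l; apply/orP; right.
suff <- : #|[set f : {ffun I -> B} | [forall j, f (e' j) \in bad' j f]]| = #|X| by [].
by rewrite cardsE.
Qed.

End Resampling.

Lemma card_ord_lt m h : h <= m -> #|[set c : 'I_m | c < h]| = h.
Proof.
move=> hm; rewrite -sum1dep_card (big_ord_narrow hm) /=.
by rewrite sum1_card card_ord.
Qed.

Lemma card_exists (T I : finType) (Q : I -> pred T) :
  #|[set x | [exists i, Q i x]]| <= \sum_i #|[set x | Q i x]|.
Proof.
rewrite -sum1_card; under [X in _ <= X]eq_bigr do rewrite -sum1_card big_mkcond.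
rewrite big_mkcond exchange_big /=; apply: leq_sum => x _; rewrite inE.
by case: existsP => // -[i Qi]; rewrite (bigD1 i) //= inE Qi.
Qed.

Lemma card_below (V : finType) m h u : h <= m ->
  #|[set x : {ffun V -> 'I_m} | x u < h]| * m = #|{ffun V -> 'I_m}| * h.
Proof.
move=> hm; have := @card_resample_const V 'I_m xpredT [set c : 'I_m | c < h] u (fun _ _ => erefl).
rewrite card_ord card_ord_lt // => <-; congr (_ * _).
by apply: eq_card => x; rewrite !inE.
Qed.

(** * Random starts and isolation *)

Section Padding.
Variables (V : finType) (L g : nat).
Implicit Types (x : {ffun V -> 'I_(2 ^ L)}) (d : V -> nat).

(** For [c] uniform below [2 ^ L], early phases are exponentially rare, and halving a [c >= 2] moves
    the start exactly [g] phases earlier. *)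
Definition start_phase (c : nat) := g * trunc_log 2 c.

Definition isolated x d u :=
  [forall (w | w != u), start_phase (x u) + d u + g <= start_phase (x w) + d w].

Definition padded x d := [exists u, isolated x d u].

Lemma isolated_uniq x d u w : 0 < g -> isolated x d u -> isolated x d w -> u = w.
Proof.
move=> g0 /forallP /(_ w) hu /forallP /(_ u) hw; apply/eqP; apply/negPn/negP => ne.
move: hu hw; rewrite ne eq_sym ne /=; lia.
Qed.

(* Halving the draw of the earliest vertex moves it [g] phases ahead of all
   the others; this map is at most two-to-one. *)
Lemma card_not_padded d :
  0 < g -> 0 < #|V| -> 4 * #|V| <= 2 ^ L ->
  4 * #|[set x | ~~ padded x d]| <= 3 * #|{ffun V -> 'I_(2 ^ L)}|.
Proof.
move=> g0 V0 hL; have /card_gt0P [u0 _] := V0.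
pose m := 2 ^ L; have m0 : 0 < m by rewrite expn_gt0.
pose Om : finType := {ffun V -> 'I_m}.
(* Draws 0 and 1 have the same logarithm, so halving them gains nothing. By a union bound, all draws
   are at least 2 with probability at least 1/2. *)
pose NS : {set Om} := [set x : Om | [forall u, 2 <= x u]].
have hNS : 2 * #|~: NS| <= #|Om|.
  have h1 : #|~: NS| <= \sum_(u : V) #|[set x : Om | x u < 2]|.
    apply: leq_trans (card_exists _); apply: subset_leq_card.
    apply/subsetP => x; rewrite !inE negb_forall => /existsP [u hu].
    by apply/existsP; exists u; rewrite ltnNge.
  have h2 : #|~: NS| * m <= #|V| * (#|Om| * 2).
    apply: leq_trans (leq_mul h1 (leqnn m)) _; rewrite big_distrl /=.
    rewrite -[X in _ <= X * _]sum1_card big_distrl /=; apply: leq_sum => u _.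
    by rewrite card_below ?mul1n // (leq_trans _ hL) //; lia.
  rewrite -(leq_pmul2r m0); apply: leq_trans (leq_mul (leqnn _) hL).
  by move: h2; rewrite /Om; lia.
have half_lt (c : 'I_m) : c./2 < m.
  by rewrite ltn_half_double -addnn (leq_trans (ltn_ord c)) ?leq_addr.
pose half (c : 'I_m) : 'I_m := Ordinal (half_lt c).
pose key (x : Om) u := start_phase (x u) + d u.
pose first (x : Om) := [arg min_(u < u0) key x u].
have firstP (x : Om) w : key x (first x) <= key x w.
  by rewrite /first; case: arg_minnP => // u _ h; apply: h.
pose F (x : Om) : Om := upd x (first x) (half (x (first x))).
have hF (x : Om) : x \in NS -> isolated (F x) d (first x).
  rewrite inE => /forallP hx; apply/forall_inP => w nw.
  rewrite /F !updE eqxx (negbTE nw); have := firstP x w.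
  rewrite /key /start_phase /= (@trunc_log2S (x (first x))) ?hx // mulnS.
  by rewrite -addnA addnC.
(* [first x] is recovered from [F x] as its only isolated vertex; the parity restores the bit lost
   by halving. *)
pose h (x : Om) := (F x, odd (x (first x))).
have inj_h : {in NS &, injective h}.
  move=> x y xN yN [eF eo].
  have exy : first x = first y.
    by apply: (isolated_uniq g0 (hF x xN)); rewrite eF hF.
  apply/ffunP => w; have /ffunP /(_ w) := eF; rewrite /F !updE -exy.
  case: eqP => [-> |//]; move=> /(congr1 val) /= e2.
  by apply: val_inj; rewrite /= -(odd_double_half (x _)) -[RHS]odd_double_half e2 eo -exy.
have : #|NS| <= #|setX [set x : Om | padded x d] [set: bool]|.
  rewrite -(card_in_imset inj_h); apply: subset_leq_card; apply/subsetP => _ /imsetP [x xN ->].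
  by rewrite !inE andbT; apply/existsP; exists (first x); apply: hF.
rewrite cardsX cardsT card_bool.
have -> : [set x : Om | ~~ padded x d] = ~: [set x : Om | padded x d].
  by apply/setP => x; rewrite !inE.
change #|{ffun V -> 'I_(2 ^ L)}| with #|Om|.
have := cardsC NS; have := cardsC [set x : Om | padded x d]; move: hNS.
move: #|NS| #|~: NS| #|~: [set x : Om | padded x d]| #|[set x : Om | padded x d]| #|Om| => *; lia.
Qed.
End Padding.

(** * Lone transmitters under decay *)

Section Decay.
Variables (V : finType) (L : nat).

(* With a uniform [c], a slot of kind [i] sees a transmission with probability
   [2 ^ - i]. *)
Definition below_kind (i : nat) (c : nat) := c < 2 ^ (L - i).

(** The kind for which the expected number of transmitters in [S] lies between 1/4 and 1/2. *)
Definition decay_kind (S : {set V}) := (trunc_log 2 #|S|).+2.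

Definition lone (S : {set V}) (x : {ffun V -> 'I_(2 ^ L)}) :=
  #|[set u in S | below_kind (decay_kind S) (x u)]| == 1.

Lemma decay_kind_bounds (S : {set V}) : 0 < #|S| -> 4 * #|S| <= 2 ^ L ->
  let h := 2 ^ (L - decay_kind S) in
  [/\ decay_kind S <= L, 2 ^ L <= 4 * (#|S| * h) & 2 * (#|S| * h) <= 2 ^ L].
Proof.
move=> S0 hL /=; rewrite /decay_kind.
have k1 := @trunc_logP 2 _ isT S0; have k2 := @trunc_log_ltn 2 #|S| isT.
set t := trunc_log 2 #|S| in k1 k2 *.
have tL : t.+2 <= L.
  by rewrite -(@leq_exp2l 2) // (leq_trans _ hL) // !expnS mulnA leq_mul2l k1 orbT.
have e : 2 ^ L = 4 * (2 ^ t * 2 ^ (L - t.+2)).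
  by rewrite -{1}(subnKC tL) expnD !expnS; lia.
split=> //; rewrite e.
  by rewrite leq_mul2l leq_mul2r k1 !orbT.
have : #|S| * 2 ^ (L - t.+2) <= 2 * 2 ^ t * 2 ^ (L - t.+2).
  by rewrite leq_mul2r -expnS (ltnW k2) orbT.
lia.
Qed.

(** For [u] in [S], the others are all silent with probability at least 1/2, independently of the
    coin of [u]. The events that [u] alone transmits are disjoint, and their probabilities add up to
    at least half the expected number of transmitters, hence to at least 1/8. *)
Lemma card_not_lone (S : {set V}) : 0 < #|S| -> 4 * #|S| <= 2 ^ L ->
  8 * #|[set x | ~~ lone S x]| <= 7 * #|{ffun V -> 'I_(2 ^ L)}|.
Proof.
move=> S0 hL; have [_ k1 k2] := decay_kind_bounds S0 hL.
pose m := 2 ^ L; have m0 : 0 < m by rewrite expn_gt0.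
pose h := 2 ^ (L - decay_kind S); have hm : h <= m by rewrite leq_exp2l // leq_subr.
pose Om : finType := {ffun V -> 'I_m}.
pose none u : pred Om := fun x => [forall (w | (w \in S) && (w != u)), ~~ (x w < h)].
pose only u := [set x : Om | none u x & x u \in [set c : 'I_m | c < h]].
have none2 u : u \in S -> #|Om| <= 2 * #|none u|.
  move=> uS; have h1 : #|[predC none u]| <= \sum_(w in S) #|[set x : Om | x w < h]|.
    rewrite big_mkcond /=.
    apply: leq_trans (_ : _ <= \sum_w #|[set x : Om | (w \in S) && (x w < h)]|) _.
      apply: leq_trans (card_exists _); apply: subset_leq_card.
      apply/subsetP => x; rewrite !inE negb_forall => /existsP [w].
      rewrite negb_imply negbK => /andP [/andP [wS _] xw].
      by apply/existsP; exists w; rewrite wS.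
    apply: leq_sum => w _; case: (w \in S) => //.
    by rewrite leqn0; apply/eqP/eq_card0 => x; rewrite inE.
  have h2 : #|[predC none u]| * m <= #|S| * (#|Om| * h).
    apply: leq_trans (leq_mul h1 (leqnn m)) _; rewrite big_distrl /=.
    rewrite -[X in _ <= X * _]sum1_card big_distrl /=; apply: leq_sum => w _.
    by rewrite card_below ?mul1n.
  have h3 : 2 * #|[predC none u]| <= #|Om|.
    rewrite -(leq_pmul2r m0); move: h2 (leq_mul (leqnn #|Om|) k2).
    rewrite -/m -/h; nia.
  have := cardC (none u); move: h3; rewrite -[#|[predC none u]|]/(#|[predC (none u)]|).
  move: #|none u| #|[predC none u]| #|Om| => *; lia.
have card_only u : u \in S -> #|Om| * h <= 2 * (#|only u| * m).
  move=> uS; have := @card_resample_const V 'I_m (none u) [set c : 'I_m | c < h] u.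
  rewrite card_ord card_ord_lt // => ->; last first.
    move=> x c; apply: eq_forallb => w; rewrite updE.
    by case: eqP => [->|]; rewrite ?eqxx ?andbF.
  by rewrite mulnA leq_mul2r none2 // orbT.
pose One := [set x : Om | lone S x].
have sum_only : \sum_(u in S) #|only u| <= #|One|.
  under eq_bigr do rewrite -sum1_card big_mkcond.
  rewrite exchange_big /= -sum1_card [X in _ <= X]big_mkcond /=; apply: leq_sum => x _.
  case: (boolP [exists u in S, x \in only u]) => [/existsP [u /andP [uS xu]]|].
    have hu w : w \in S -> (x w < h) = (w == u).
      move: xu; rewrite !inE => /andP [/forallP nu xu] wS.
      case: eqP => [->//|/eqP nw]; apply/negbTE.
      by have /implyP := nu w; apply; rewrite wS.
    rewrite (bigD1 u) //= xu big1 => [|w /andP [wS wu]].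
      suff -> : x \in One by [].
      rewrite inE /lone (_ : [set _ in S | _] = [set u]) ?cards1 //.
      apply/setP => w; rewrite !inE /below_kind -/h.
      case: (boolP (w \in S)) => [/hu -> //|wS]; apply/esym/negbTE.
      by apply: contraNneq wS => ->.
    case: ifP => //; rewrite !inE => /andP [_]; rewrite hu //.
    by rewrite (negbTE wu).
  rewrite negb_exists => /forallP nx; rewrite big1 // => u uS.
  by have := nx u; rewrite uS /= => /negbTE ->.
have hOne : #|Om| <= 8 * #|One|.
  have s1 : #|S| * (#|Om| * h) <= 2 * (#|One| * m).
    apply: leq_trans (_ : \sum_(u in S) 2 * (#|only u| * m) <= _).
      rewrite -[X in X * _ <= _]sum1_card big_distrl /=; apply: leq_sum => u uS.
      by rewrite mul1n card_only.
    by rewrite -big_distrr -big_distrl /= leq_mul2l leq_mul2r sum_only !orbT.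
  rewrite -(leq_pmul2r m0); move: s1 (leq_mul (leqnn #|Om|) k1).
  rewrite -/m -/h; nia.
have -> : [set x : Om | ~~ lone S x] = ~: One by apply/setP => x; rewrite !inE.
change #|{ffun V -> 'I_(2 ^ L)}| with #|Om|.
have := cardsC One; move: hOne; move: #|One| #|~: One| #|Om| => *; lia.
Qed.
End Decay.

(** * Distances and casts *)

Section Within.
Variable n : nat.
Implicit Types (e f : rel 'I_n) (u v w : 'I_n) (k : nat).

Lemma within_refl e k u : within e k u u.
Proof. by elim: k => //= k ->. Qed.

Lemma within_leq e k k' u v : k <= k' -> within e k u v -> within e k' u v.
Proof.
elim: k' => [|k' IH] /=; first by rewrite leqn0 => /eqP ->.
by rewrite leq_eqVlt => /orP [/eqP -> //| /IH h /h ->].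
Qed.

Lemma withinS e k u w v : within e k u w -> e w v -> within e k.+1 u v.
Proof. by move=> h ewv /=; apply/orP; right; apply/existsP; exists w; rewrite h. Qed.

Lemma within1 e u v : e u v -> within e 1 u v.
Proof. exact: (@withinS e 0 u u v (eqxx _)). Qed.

Lemma within_trans e j k u w v :
  within e j u w -> within e k w v -> within e (j + k) u v.
Proof.
move=> h; elim: k v => [|k IH] v /=; first by rewrite addn0 => /eqP <-.
rewrite addnS => /orP [/IH h1|/existsP [x /andP [/IH h1 exv]]].
  by rewrite /= h1.
exact: withinS h1 exv.
Qed.

Lemma within_split e j k u v :
  within e (j + k) u v -> exists2 w, within e j u w & within e k w v.
Proof.
elim: k v => [|k IH] v; first by rewrite addn0 => h; exists v => //=.
rewrite addnS /= => /orP [/IH [w h1 h2]|/existsP [x /andP [/IH [w h1 h2] exv]]].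
  by exists w => //; rewrite h2.
by exists w => //; apply: withinS exv.
Qed.

Lemma within_sym e k u v : symmetric e -> within e k u v -> within e k v u.
Proof.
move=> se; elim: k v => [|k IH] v /=; first by rewrite eq_sym.
case/orP=> [/IH -> //|/existsP [x /andP [/IH h exv]]].
by rewrite -[within e k v u || _]/(within e (1 + k) v u) (within_trans _ h) // within1 // se.
Qed.

Lemma within_coarsen e f r b u v :
  (forall u v, within e r u v -> f u v) ->
  within e (b * r) u v -> within f b u v.
Proof.
move=> h; elim: b v => [|b IH] v; first by rewrite mul0n.
rewrite mulSnr => /within_split [w /IH h1 /h h2]; exact: withinS h1 h2.
Qed.

(** Balls around an endpoint of a diameter grow strictly at each radius below the diameter: a ball
    that stops growing once is stable forever. *)
Lemma diameter_le e D : has_diameter e D -> D <= n.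
Proof.
case: D => // D [hD /(_ isT)] [u [v /= nuv]].
pose ball k := [set w | within e k u w].
have strict k : k <= D -> ball k \proper ball k.+1.
  move=> kD; rewrite properE; apply/andP; split.
    by apply/subsetP => w; rewrite !inE /= => ->.
  apply: contra nuv => /subsetP sub.
  have stable j w : within e (k + j) u w -> within e k u w.
    elim: j w => [|j IH] w; first by rewrite addn0.
    rewrite addnS /= => /orP [/IH //|/existsP [x /andP [/IH h exw]]].
    have := sub w; rewrite !inE; apply; exact: withinS h exw.
  apply: (within_leq kD); apply: (stable (D.+1 - k)).
  by rewrite subnKC; [exact (hD u v) | exact: leqW].
have card_ball k : k <= D.+1 -> k < #|ball k|.
  elim: k => [_|k IH kD]; first by apply/card_gt0P; exists u; rewrite inE /= eqxx.
  by apply: leq_ltn_trans (proper_card (strict k _)); [apply: IH; exact: ltnW|].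
have := card_ball D.+1 (leqnn _); have := max_card (ball D.+1).
rewrite card_ord; lia.
Qed.

Definition graph_dist e D u v := find (fun k => within e k u v) (iota 0 D.+1).

Section Dist.
Variables (e : rel 'I_n) (D : nat).
Hypothesis connected : forall u v, within e D u v.

Lemma within_dist u v : within e (graph_dist e D u v) u v.
Proof.
have h : has (fun k => within e k u v) (iota 0 D.+1).
  by apply/hasP; exists D; rewrite ?mem_iota ?leqnn.
have := nth_find 0 h; rewrite -/(graph_dist e D u v) nth_iota //.
by rewrite -(size_iota 0 D.+1) -has_find.
Qed.

Lemma dist_leq k u v : within e k u v -> graph_dist e D u v <= k.
Proof.
move=> h; rewrite leqNgt; apply/negP => lt.
have lt' : k < D.+1.
  by apply: leq_trans lt _; rewrite -[X in _ <= X](size_iota 0) find_size.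
by have := before_find 0 lt; rewrite nth_iota // add0n h.
Qed.

Lemma dist_triangle u v w k : within e k v w -> graph_dist e D u w <= graph_dist e D u v + k.
Proof. by move=> h; apply: dist_leq; apply: within_trans (within_dist _ _) h. Qed.
End Dist.
End Within.

(** * Idealized spreading and casts *)

Section Spread.
Variables (n : nat) (adj : rel 'I_n) (act : nat -> pred 'I_n).

Fixpoint spread (k : nat) (S : {set 'I_n}) : {set 'I_n} :=
  if k is k'.+1 then
    spread k' S :|: [set v | act k' v && [exists u in spread k' S, adj v u && act k' u]]
  else S.

Lemma spread_leq k k' S v : k <= k' -> v \in spread k S -> v \in spread k' S.
Proof.
elim: k' => [|k' IH] /=; first by rewrite leqn0 => /eqP ->.
by rewrite leq_eqVlt => /orP [/eqP -> //|/IH h /h]; rewrite inE => ->.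
Qed.

Lemma spreadS k S u v :
  u \in spread k S -> adj v u -> act k u -> act k v -> v \in spread k.+1 S.
Proof.
move=> h1 h2 h3 h4; rewrite /= !inE h4 /=; apply/orP; right.
by apply/existsP; exists u; rewrite h1 h2.
Qed.

(** This is the precise sense in which [v] lies above the root [u]. *)
Fixpoint chain (lam : 'I_n -> option nat) (k : nat) (v u : 'I_n) : Prop :=
  lam v = Some k /\
  (if k is k'.+1 then exists2 w, adj v w & chain lam k' w u else v = u).

Lemma chain_label lam k v u : chain lam k v u -> lam v = Some k.
Proof. by case: k => [|k] []. Qed.

Lemma chain_mono lam lam' k v u :
  (forall v y, lam v = Some y -> lam' v = Some y) ->
  chain lam k v u -> chain lam' k v u.
Proof.
move=> h; elim: k v => [|k IH] v /= [/h -> c]; split=> //.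
by case: c => w aw /IH ?; exists w.
Qed.

Definition near a b := (a <= b.+1) && (b <= a.+1).

Section Cast.
Variables (M j r : nat) (lam : 'I_n -> option nat).
Hypotheses (jM : j < M) (adj_sym : symmetric adj).
(** The [M] casts are interleaved. With truncated subtraction, [(r - k) + (k - r)] is the distance
    from [k] to [r]: the speaking layer descends to 0 and then climbs. Being awake for the adjacent
    layers too lets a vertex both receive and pass on. *)
Hypothesis act_cast : forall k v y, k <= 2 * r -> lam v = Some y ->
  near y ((r - k) + (k - r)) -> act (1 + (k * M + j)) v.

Let T k := 1 + (k * M + j).

Let T_leq k k' : k < k' -> (T k).+1 <= T k'.
Proof.
move=> h; rewrite /T !add1n !ltnS addnC -addnS addnC.
apply: leq_trans (_ : k.+1 * M + j <= _); first by rewrite mulSn; lia.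
by rewrite leq_add2r leq_mul2r h orbT.
Qed.

Lemma spread_up S y v u : y <= r ->
  v \in spread (T (r - y)) S -> chain lam y v u -> u \in spread (T r) S.
Proof.
elim: y v => [|y IH] v yr; first by rewrite subn0 => ? [_ <-].
move=> vS [lv [w avw cw]]; apply: IH (cw); first exact: ltnW.
apply: spread_leq (T_leq _) (spreadS vS _ _ _); first lia.
- by rewrite adj_sym.
- by apply: (act_cast _ lv); [lia | rewrite /near; lia].
- by apply: (act_cast _ (chain_label cw)); [lia | rewrite /near; lia].
Qed.

Lemma spread_down S y w u : y <= r ->
  u \in spread (T r) S -> chain lam y w u -> w \in spread (T (r + y)) S.
Proof.
elim: y w => [|y IH] w yr uS; first by rewrite addn0 => -[_ ->].
move=> [lw [w' aww cw]]; have wS := IH _ (ltnW yr) uS cw.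
apply: spread_leq (T_leq _) (spreadS wS aww _ _); first lia.
- by apply: (act_cast _ (chain_label cw)); [lia | rewrite /near; lia].
- by apply: (act_cast _ lw); [lia | rewrite /near; lia].
Qed.

Lemma spread_cast N y y' v w u : 1 + M * (2 * r + 1) <= N -> y <= r -> y' <= r ->
  chain lam y v u -> chain lam y' w u -> w \in spread N [set v].
Proof.
move=> hN yr yr' cv cw.
have hu : u \in spread (T r) [set v].
  by apply: spread_up yr _ cv; apply: (@spread_leq 0) => //; rewrite inE.
apply: spread_leq (spread_down yr' hu cw); apply: leq_trans hN.
rewrite /T; nia.
Qed.
End Cast.
End Spread.

(** * Waves *)

(* [o t v] is the value held by [v] before microstep [t]; phase [t %/ N] starts
   by giving the value [z] to the vertices whose [start] has come, and in
   microstep [t] the values spread between neighbours in [act (t %% N)]. *)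
Record wave_run n (adj : rel 'I_n) (act : nat -> pred 'I_n) (N P : nat)
    (start : 'I_n -> nat) (inc : nat -> nat) (z : nat)
    (o : nat -> 'I_n -> option nat) : Prop := WaveRun {
  run_begin : forall v y, o 0 v = Some y -> start v = 0 /\ y = z;
  run_stay : forall t v y, t < P * N -> o t v = Some y -> o t.+1 v = Some y;
  run_learn : forall t v y, t < P * N -> o t v = None -> o t.+1 v = Some y ->
    (start v <= t.+1 %/ N /\ y = z) \/
    (act (t %% N) v /\
     exists u x, [/\ adj v u, act (t %% N) u, o t u = Some x & y = inc x]);
  run_inject : forall t v, t <= P * N -> start v <= t %/ N -> o t v;
  run_advance : forall t u v, t < P * N -> act (t %% N) v -> act (t %% N) u ->
    adj v u -> o t u -> o t.+1 v }.

Section Wave.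
Variables (n : nat) (adj : rel 'I_n) (act : nat -> pred 'I_n) (N P : nat).
Variables (start : 'I_n -> nat) (inc : nat -> nat) (z : nat).
Variable o : nat -> 'I_n -> option nat.
Hypothesis N_gt0 : 0 < N.
Hypothesis run : wave_run adj act N P start inc z o.

Definition hop : rel 'I_n := fun x y => y \in spread adj act N [set x].

Lemma tick t : (t.+1 %/ N = t %/ N /\ t.+1 %% N = (t %% N).+1) \/
  (t.+1 %/ N = (t %/ N).+1 /\ t.+1 %% N = 0 /\ (t %% N).+1 = N).
Proof.
have hm := ltn_pmod t N_gt0.
have -> : t.+1 = t %/ N * N + (t %% N).+1 by rewrite addnS -divn_eq.
have [lt|ge] := ltnP (t %% N).+1 N.
  by left; rewrite divnMDl // (divn_small lt) addn0 modnMDl (modn_small lt).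
have e : (t %% N).+1 = N by apply/eqP; rewrite eqn_leq hm.
by right; rewrite e -mulSnr mulnK // modnMl.
Qed.

Lemma run_stays t t' v y : t <= t' -> t' <= P * N -> o t v = Some y -> o t' v = Some y.
Proof.
move=> tt' le h; elim: t' tt' le => [|t' IH]; first by rewrite leqn0 => /eqP <-.
rewrite leq_eqVlt => /orP [/eqP <- //|lt le].
by apply: (run_stay run) => //; apply: IH => //; apply: ltnW.
Qed.

Lemma run_spread p k x v : p < P -> k <= N -> o (p * N) x ->
  v \in spread adj act k [set x] -> o (p * N + k) v.
Proof.
move=> pP; have lt j : j < N -> p * N + j < P * N by move=> jN; nia.
elim: k v => [|k IH] v kN ox /=; first by rewrite addn0 inE => /eqP ->.
rewrite !inE addnS => /orP [/(IH _ (ltnW kN) ox)|].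
  case e: (o _ v) => [y|//] _.
  by rewrite (run_stay run (lt _ kN) e).
case/andP=> av /existsP [u /andP [uS /andP [avu au]]].
have ou := IH _ (ltnW kN) ox uS.
by apply: (run_advance run _ _ _ avu ou); rewrite ?modnMDl ?modn_small // lt.
Qed.

(** An upper bound on arrival times: no wave can delay another one, as a vertex already reached
    passes on whatever value it holds. *)
Lemma run_within k u v : start u + k <= P -> within hop k u v ->
  o ((start u + k) * N) v.
Proof.
elim: k v => [|k IH] v; first rewrite addn0 => sP /eqP <-.
  by apply: (run_inject run); rewrite ?mulnK // leq_mul2r sP orbT.
rewrite addnS => sP /= /orP [/(IH _ (ltnW sP))|/existsP [x /andP [/(IH _ (ltnW sP)) ox hv]]].
  case e: (o _ v) => [y|//] _.
  by rewrite (run_stays _ _ e) // leq_mul2r ?leqnSn ?orbT // sP orbT.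
by rewrite mulSnr; apply: run_spread ox hv.
Qed.

(* A cause of [v] holding a value before microstep [t]: the wave of root [u]. *)
Definition caused t u v := exists x,
  [/\ start u <= t %/ N, within hop (t %/ N - start u) u x &
      v \in spread adj act (t %% N) [set x]].

Lemma caused_next t u v x : start u <= t %/ N ->
  within hop (t %/ N - start u) u x ->
  v \in spread adj act (t %% N).+1 [set x] -> caused t.+1 u v.
Proof.
move=> su ux xv; case: (tick t) => [[ed em]|[ed [em eN]]].
  by exists x; rewrite ed em.
exists v; rewrite ed em inE eqxx; split=> //; first exact: leqW.
by rewrite subSn //; apply: withinS ux _; rewrite /hop -eN.
Qed.

Lemma caused_stay t u v : caused t u v -> caused t.+1 u v.
Proof.
by move=> [x [su ux xv]]; apply: caused_next su ux (spread_leq (leqnSn _) xv).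
Qed.

Lemma caused_recv t u v w : act (t %% N) v -> act (t %% N) w -> adj v w ->
  caused t u w -> caused t.+1 u v.
Proof.
by move=> av aw avw [x [su ux xv]]; apply: caused_next su ux (spreadS xv avw aw av).
Qed.

Lemma caused_root t v : start v <= t %/ N -> caused t v v.
Proof.
move=> sv; exists v; split => //; first exact: within_refl.
by apply: (@spread_leq _ _ _ 0); rewrite ?inE.
Qed.

Lemma run_value_ind (Q : nat -> Prop) : Q z -> (forall x, Q x -> Q (inc x)) ->
  forall t v y, t <= P * N -> o t v = Some y -> Q y.
Proof.
move=> Qz Qi; elim=> [|t IH] v y tP; first by move=> /(run_begin run) [_ ->].
case e: (o t v) => [y'|] h.
  by have := run_stay run tP e; rewrite h => -[->]; apply: IH e; apply: ltnW.
case: (run_learn run tP e h) => [[_ -> //]|[_ [u [x [_ _ ou ->]]]]].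
by apply/Qi/(IH u) => //; apply: ltnW.
Qed.

Section Labels.
Hypotheses (incE : inc =1 S) (zE : z = 0).

(** The chain and the cause grow by the same transmissions, so they share their root; a bound on
    arrival times then restricts the root of the chain. *)
Lemma run_chain t v y : t <= P * N -> o t v = Some y ->
  exists2 u, chain adj (o t) y v u & caused t u v.
Proof.
elim: t v y => [|t IH] v y tP.
  move=> h; have [sv ey] := run_begin run h; exists v.
    by rewrite ey zE /= h ey zE.
  by apply: caused_root; rewrite sv.
have mono := fun v y => @run_stay _ _ _ _ _ _ _ _ _ run t v y tP.
case e: (o t v) => [y'|] h.
  have := mono _ _ e; rewrite h => -[->].
  have [u c hu] := IH _ _ (ltnW tP) e.
  by exists u; [apply: chain_mono c | apply: caused_stay].
case: (run_learn run tP e h) => [[sv ey]|[av [u [x [avu au ou ey]]]]].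
  exists v; last exact: caused_root.
  by rewrite ey zE /= h ey zE.
have [w c hw] := IH _ _ (ltnW tP) ou.
exists w; last exact: caused_recv hw.
rewrite ey incE /=; split; first by rewrite h ey incE.
by exists u => //; apply: chain_mono c.
Qed.

(** A label can grow by one per microstep only while somebody is active, that is [K] times per
    phase, however long the phase [N] is. *)
Lemma run_label_leq K t v y : (forall k v, act k v -> k < K) ->
  t <= P * N -> o t v = Some y -> y <= (t %/ N) * K + minn (t %% N) K.
Proof.
move=> hK; elim: t v y => [|t IH] v y tP.
  by move=> /(run_begin run) [_ ->]; rewrite zE.
have step : (t %/ N) * K + minn (t %% N) K <= (t.+1 %/ N) * K + minn (t.+1 %% N) K.
  by case: (tick t) => [[-> ->]|[-> [-> _]]]; nia.
case e: (o t v) => [y'|] h.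
  have := run_stay run tP e; rewrite h => -[->].
  exact: leq_trans (IH _ _ (ltnW tP) e) step.
case: (run_learn run tP e h) => [[_ ->]|[_ [u [x [_ /hK au ou ->]]]]]; first by rewrite zE.
rewrite incE; have := IH _ _ (ltnW tP) ou.
by case: (tick t) => [[-> ->]|[-> [-> eN]]]; nia.
Qed.

(** If [w] hangs from [x], then [x] reached [w] no later than [u] could; moving from [w] to [v]
    costs at most [2 * b < g] phases in the comparison, which contradicts isolation unless [x = u].
    Both directions between [v] and [w] are assumed because [hop] need not be symmetric. *)
Lemma run_isolated D b g u v w :
  (forall x y, within hop D x y) -> 2 * b < g ->
  (forall x, start x < P) ->
  (forall x, x != u ->
     start u + graph_dist hop D u v + g <= start x + graph_dist hop D x v) ->
  within hop b v w -> within hop b w v ->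
  exists2 y, o (P * N) w = Some y & chain adj (o (P * N)) y w u.
Proof.
move=> hD hg hs iso vw wv.
have tri x := dist_triangle hD x vw; have tri' x := dist_triangle hD x wv.
have dww : graph_dist hop D w w <= 0 by apply: dist_leq => //; apply: within_refl.
have dwv : graph_dist hop D w v <= b by apply: dist_leq.
(* The wave of [u] reaches [w] no later than [w] would start itself, hence before the run ends. *)
have le_sw : start u + graph_dist hop D u w <= start w.
  have [eq|ne] := eqVneq w u; first by rewrite -eq; lia.
  by have := iso w ne; have := tri u; lia.
have le_P : start u + graph_dist hop D u w < P by apply: leq_ltn_trans le_sw (hs w).
have := run_within (ltnW le_P) (within_dist hD u w).
set t := _ * N; have tP : t <= P * N by rewrite leq_mul2r (ltnW le_P) orbT.
case e: (o t w) => [y|//] _.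
(* Microstep [t] opens a phase, so the partial spread in [caused] is trivial and its source [x'] is
   [w]. *)
have [x c [x' []]] := run_chain tP e; rewrite mulnK // modnMl /= inE => sx xx /eqP ex'.
have {xx ex'} dx : graph_dist hop D x w <= start u + graph_dist hop D u w - start x.
  by move: xx; rewrite -ex'; apply: dist_leq.
 have mono : forall v y, o t v = Some y -> o (P * N) v = Some y.
  by move=> v' y'; apply: run_stays.
exists y; first exact: mono.
suff -> : u = x by apply: chain_mono c.
apply/eqP; apply/negPn/negP => ne.
have := iso x; rewrite eq_sym ne => /(_ isT).
by have := tri x; have := tri u; have := tri' x; lia.
Qed.
End Labels.
End Wave.

(** * The algorithm *)

Section Decode.
Variables (L K : nat).

Lemma card_draws : #|{ffun 'I_K -> 'I_(2 ^ L)}| = #|{: (L * K).-tuple bool}|.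
Proof. by rewrite card_ffun !card_ord card_tuple card_bool expnM. Qed.

(** Any bijection between tapes and families of draws preserves uniformity; this one goes through
    the enumerations of the two types. *)
Definition decode (r : (L * K).-tuple bool) : {ffun 'I_K -> 'I_(2 ^ L)} :=
  enum_val (cast_ord (esym card_draws) (enum_rank r)).

Definition encode (f : {ffun 'I_K -> 'I_(2 ^ L)}) : (L * K).-tuple bool :=
  enum_val (cast_ord card_draws (enum_rank f)).

Lemma encodeK : cancel encode decode.
Proof. by move=> f; rewrite /decode /encode enum_valK cast_ordK enum_rankK. Qed.

Lemma decodeK : cancel decode encode.
Proof. by move=> f; rewrite /decode /encode enum_valK cast_ordKV enum_rankK. Qed.

Definition draw (f : {ffun 'I_K -> 'I_(2 ^ L)}) (t : nat) : nat :=
  if insub t is Some i then val (f i) else 0.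

Lemma draw_lt f t : draw f t < 2 ^ L.
Proof. by rewrite /draw; case: insubP => *; rewrite ?ltn_ord ?expn_gt0. Qed.
End Decode.

Definition heard a (h : seq (option nat)) : option nat := ohead (pmap idfun (drop a h)).

Lemma heard_rcons a h x : a <= size h ->
  heard a (rcons h x) = if heard a h is Some y then Some y else x.
Proof.
move=> ah; rewrite /heard drop_rcons // -cats1 pmap_cat.
by case: (pmap idfun _) => //; case: x.
Qed.

Lemma heard_oversize a h : size h <= a -> heard a h = None.
Proof. by move=> ah; rewrite /heard drop_oversize. Qed.

Section Algorithm.
Variables (L b q reps : nat).

(* Wave [w] has level [w %/ nwaves]; the last one, alone on level [q], carries the
   message. A microstep is a block of [reps] rounds of decay. *)
Definition nwaves := 12 * L.
Definition gap := 2 * b + 1.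
(** A start is at most [gap * L], so every vertex starts before a labeling wave ends. *)
Definition nphases := gap * L + 1.
Definition radius i := (4 * nwaves * nphases) ^ i.
(** The length of a phase is set by level [q]; at lower levels everybody idles through the rest of
    the phase. *)
Definition nsteps := 1 + nwaves * (2 * radius q + 1).
Definition nslots := reps * L.+1.
Definition wave_len := nphases * nsteps * nslots.
Definition last_wave := q * nwaves.
Definition nrounds := last_wave.+1 * wave_len.
Definition ndraws := nrounds + last_wave.

(** A vertex that heard nothing during the wave started by itself and is a root. The [take] makes
    the label the same when recomputed at any later time. *)
Definition label w (h : seq (option nat)) : nat :=
  if heard (w * wave_len) (take (w.+1 * wave_len) h) is Some x then x.+1 else 0.

Definition level_label i j h : nat := if i is i'.+1 then label (i' * nwaves + j) h else 0.

(* Everybody is active in microstep 0. Microstep [1 + (k * nwaves + j)] belongs to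
   the cast along labeling [j]; its layer is [|radius i - k|], which goes down from
   [radius i] to 0 and up again. *)
Definition active i k (lab : nat -> nat) : bool :=
  (k == 0) ||
  (k.-1 %/ nwaves <= 2 * radius i) &&
  near (lab (k.-1 %% nwaves))
       ((radius i - k.-1 %/ nwaves) + (k.-1 %/ nwaves - radius i)).

(* Draw [t] of a vertex is its decay coin in slot [t]; draw [nrounds + w] is its
   start in wave [w]. *)
Definition start_of w (inp : option nat) (f : {ffun 'I_ndraws -> 'I_(2 ^ L)}) : nat :=
  if w < last_wave then start_phase gap (draw f (nrounds + w))
  else if inp is Some _ then 0 else nphases.+1.

Definition incr w x := if w < last_wave then x.+1 else x.

Definition value w p inp f h : option nat :=
  if heard (w * wave_len) h is Some x then Some (incr w x)
  else if start_of w inp f <= p then Some (if w < last_wave then 0 else odflt 0 inp)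
  else None.

Definition action_at inp f t w s (h : seq (option nat)) : action :=
  if active (w %/ nwaves) (s %% nsteps) (fun j => level_label (w %/ nwaves) j h) then
    if value w (s %/ nsteps) inp f h is Some x then
      if below_kind L (t %% L.+1) (draw f t) then Transmit x else Idle
    else Listen
  else Idle.

(** The history is cut at the start of the current microstep: who is awake and who holds a value is
    then fixed during the block, independently of its decay coins. *)
Definition broadcast_algorithm : algorithm :=
  @Algorithm (L * ndraws) nrounds
    (fun inp r h => let t := size h in
      let w := t %/ wave_len in let s := (t %% wave_len) %/ nslots in
      action_at inp (decode r) t w s (take (w * wave_len + s * nslots) h))
    (fun inp r h => odflt 0 (value last_wave nphases inp (decode r) h)).

(** * From executions to abstract waves *)

Section Execution.
Variables (n : nat) (adj : rel 'I_n) (s : 'I_n) (m : nat).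
Variable r : tapes broadcast_algorithm n.
Hypotheses (L_gt0 : 0 < L) (reps_gt0 : 0 < reps).

Let H := hist adj s m r.
Let f v := decode (r v).
Let inp := input s m.

Lemma nwaves_gt0 : 0 < nwaves. Proof. by rewrite muln_gt0 L_gt0. Qed.
Lemma nphases_gt0 : 0 < nphases. Proof. by rewrite /nphases addn1. Qed.
Lemma nsteps_gt0 : 0 < nsteps. Proof. by []. Qed.
Lemma nslots_gt0 : 0 < nslots. Proof. by rewrite muln_gt0 reps_gt0. Qed.
Lemma wave_len_gt0 : 0 < wave_len.
Proof. by rewrite /wave_len 2!muln_gt0 nphases_gt0 nslots_gt0. Qed.

Lemma size_hist t v : size (H t v) = t.
Proof. by elim: t => //= t IH; rewrite size_rcons IH. Qed.

Lemma take_hist t t' v : t <= t' -> take t (H t' v) = H t v.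
Proof.
elim: t' => [|t' IH]; first by rewrite leqn0 => /eqP ->.
rewrite leq_eqVlt => /orP [/eqP ->|lt]; first by rewrite take_oversize // size_hist.
by rewrite /= -cats1 takel_cat ?size_hist // IH.
Qed.

Definition time w t := w * wave_len + t * nslots.

Definition act_in w t v :=
  active (w %/ nwaves) (t %% nsteps)
    (fun j => level_label (w %/ nwaves) j (H (time w t) v)).

Definition value_in w t v :=
  value w (t %/ nsteps) (inp v) (f v) (H (time w t) v).

Lemma act_of_hist w t c v : t < nphases * nsteps -> c < nslots ->
  act_of s m r (H (time w t + c)) v =
  action_at (inp v) (f v) (time w t + c) w t (H (time w t) v).
Proof.
move=> tP cD; rewrite /act_of /= size_hist.
have lt : t * nslots + c < wave_len.
  apply: leq_trans (_ : t.+1 * nslots <= _); first by rewrite mulSnr ltn_add2l.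
  by rewrite leq_mul2r tP orbT.
have -> : (time w t + c) %/ wave_len = w.
  by rewrite /time -addnA divnMDl ?wave_len_gt0 // (divn_small lt) addn0.
have -> : (time w t + c) %% wave_len = t * nslots + c.
  by rewrite /time -addnA modnMDl (modn_small lt).
rewrite divnMDl ?nslots_gt0 // (divn_small cD) addn0.
by rewrite -/(time w t) take_hist // leq_addr.
Qed.

Lemma obs_Some h v x : obs adj s m r h v = Some x ->
  act_of s m r h v = Listen /\ exists2 u, adj v u & act_of s m r h u = Transmit x.
Proof.
rewrite /obs; case e: (act_of s m r h v) => //; case: ifP => // _.
case: pickP => // u; rewrite inE => /andP [avu _].
by case eu: (act_of s m r h u) => [||y] //= [<-]; split=> //; exists u.
Qed.

Lemma obs_single h v : act_of s m r h v = Listen ->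
  #|[set u | adj v u && is_transmit (act_of s m r h u)]| = 1 ->
  obs adj s m r h v.
Proof.
rewrite /obs => -> c1; rewrite c1 eqxx.
case: pickP => [u|n0]; first by rewrite inE => /andP [_]; case: (act_of _ _ _ _ _).
by move/eqP: c1; rewrite eq_card0.
Qed.

Lemma heard_hist w t v : w * wave_len <= t ->
  heard (w * wave_len) (H t.+1 v) =
  if heard (w * wave_len) (H t v) is Some y then Some y else obs adj s m r (H t) v.
Proof. by move=> wt; rewrite [H t.+1 v]/= heard_rcons ?size_hist. Qed.

Lemma heard_stays w t c v x : w * wave_len <= t ->
  heard (w * wave_len) (H t v) = Some x -> heard (w * wave_len) (H (t + c) v) = Some x.
Proof.
move=> wt h; elim: c => [|c IH]; first by rewrite addn0.
by rewrite addnS heard_hist ?IH // (leq_trans wt) ?leq_addr.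
Qed.

Lemma time_geq w t : w * wave_len <= time w t.
Proof. exact: leq_addr. Qed.

Lemma timeS w t : time w t.+1 = time w t + nslots.
Proof. by rewrite /time mulSnr addnA. Qed.

Lemma heard_learn w t c v x : t < nphases * nsteps -> c <= nslots ->
  heard (w * wave_len) (H (time w t) v) = None ->
  heard (w * wave_len) (H (time w t + c) v) = Some x ->
  [/\ act_in w t v, value_in w t v = None &
      exists u, [/\ adj v u, act_in w t u & value_in w t u = Some x]].
Proof.
move=> tP; elim: c => [|c IH] cD h0; first by rewrite addn0 h0.
rewrite addnS heard_hist ?(leq_trans (time_geq w t)) ?leq_addr //.
case e: (heard _ _) => [y|] hx.
  by apply: IH h0 _; [apply: ltnW | rewrite e].
move: hx => /obs_Some [+ [u avu]]; rewrite !act_of_hist // /action_at.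
rewrite -/(act_in w t v) -/(value_in w t v) -/(act_in w t u) -/(value_in w t u).
case: (act_in w t v) => //; case: (value_in w t v) => [y|] ; first by case: ifP.
move=> _; case eu: (act_in w t u) => //; case ex: (value_in w t u) => [y|//].
by case: ifP => // _ [<-]; split=> //; exists u.
Qed.

Lemma heard_lone w t v c : t < nphases * nsteps -> c < nslots ->
  act_in w t v -> ~~ value_in w t v ->
  #|[set u | [&& adj v u, act_in w t u & value_in w t u] &&
      below_kind L ((time w t + c) %% L.+1) (draw (f u) (time w t + c))]| = 1 ->
  heard (w * wave_len) (H (time w t.+1) v).
Proof.
move=> tP cD av nv c1; have le : w * wave_len <= time w t + c.
  by rewrite (leq_trans (time_geq w t)) ?leq_addr.
have hc : heard (w * wave_len) (H (time w t + c).+1 v).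
  rewrite heard_hist //; case: (heard _ _) => [x|] //.
  apply: obs_single; first rewrite act_of_hist // /action_at -/(act_in w t v) av.
    by rewrite -/(value_in w t v); case: (value_in w t v) nv.
  rewrite -c1; apply: eq_card => u; rewrite !inE act_of_hist // /action_at.
  rewrite -/(act_in w t u) -/(value_in w t u) -!andbA.
  case: (adj v u) => //=; case: (act_in w t u) => //=.
  by case: (value_in w t u) => [x|] //=; case: ifP.
case e: (heard _ _) hc => [x|//] _.
have -> : time w t.+1 = (time w t + c).+1 + (nslots - c.+1).
  by rewrite timeS -addnS -addnA subnKC.
by rewrite (heard_stays _ _ e) // leqW.
Qed.

(** The bad event of decay: [v] could have learned a value in microstep [t] and heard nothing in the
    whole block. *)
Definition fails w t v := [&& act_in w t v, ~~ value_in w t v,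
  [exists u, [&& adj v u, act_in w t u & value_in w t u]] &
  ~~ heard (w * wave_len) (H (time w t.+1) v)].

Lemma level_label_hist i j t v : j < nwaves -> i * nwaves * wave_len <= t ->
  level_label i j (H t v) = level_label i j (H (i * nwaves * wave_len) v).
Proof.
case: i => //= i jM it; rewrite /label !take_hist //.
  by rewrite leq_mul2r mulSnr -addnS leq_add2l jM orbT.
by apply: leq_trans it; rewrite leq_mul2r mulSnr -addnS leq_add2l jM orbT.
Qed.

Definition lam i j v := level_label i j (H (i * nwaves * wave_len) v).

Definition act_level i k : pred 'I_n := fun v => active i k (fun j => lam i j v).

Lemma act_inE w t v : act_in w t v = act_level (w %/ nwaves) (t %% nsteps) v.
Proof.
rewrite /act_in /act_level /active /lam (level_label_hist _ (ltn_pmod _ nwaves_gt0)) //.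
by apply: leq_trans (time_geq w t); rewrite leq_mul2r leq_trunc_div orbT.
Qed.

Lemma value_in_Some w t v x : heard (w * wave_len) (H (time w t) v) = Some x ->
  value_in w t v = Some (incr w x).
Proof. by rewrite /value_in /value => ->. Qed.

(** Values arise and persist as in an abstract wave by construction; the absence of failures
    provides [run_advance]. *)
Lemma wave_run_hist w :
  (forall t v, t < nphases * nsteps -> ~~ fails w t v) ->
  wave_run adj (act_level (w %/ nwaves)) nsteps nphases
    (fun v => start_of w (inp v) (f v)) (incr w)
    (if w < last_wave then 0 else m) (value_in w).
Proof.
(* In the last wave, the start [nphases.+1] of the other vertices lies beyond every phase number, so
   only the source starts. *)
have init_val v p : p <= nphases -> start_of w (inp v) (f v) <= p ->
    (if w < last_wave then 0 else odflt 0 (inp v)) = if w < last_wave then 0 else m.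
  rewrite /start_of; case: ifP => // _; rewrite /inp /input; case: ifP => //.
  by move=> _ pP; rewrite leqNgt ltnS pP.
have in_phase t : t <= nphases * nsteps -> t %/ nsteps <= nphases.
  by move=> tP; rewrite -(mulnK nphases nsteps_gt0) leq_div2r.
move=> ok; split.
- move=> v y; rewrite /value_in /value /time div0n addn0 heard_oversize ?size_hist //.
  case: ifP => // s0 [<-]; rewrite (init_val _ _ _ s0) //; split=> //.
  by apply/eqP; rewrite -leqn0.
- move=> t v y tP; case e: (heard (w * wave_len) (H (time w t) v)) => [x|].
    rewrite (value_in_Some e) => -[<-]; apply: value_in_Some.
    by rewrite timeS; apply: heard_stays e; apply: time_geq.
  move=> hy; rewrite -hy; move: hy; rewrite /value_in /value e.
  case: ifP => // st _; case e': (heard _ (H (time w t.+1) v)) => [x|].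
    rewrite timeS in e'; have [_ + _] := heard_learn tP (leqnn _) e e'.
    by rewrite /value_in /value e st.
  by rewrite (leq_trans st) // leq_div2r.
- move=> t v y tP hn; case e': (heard (w * wave_len) (H (time w t.+1) v)) => [x|].
    rewrite (value_in_Some e') => -[<-]; right.
    case e: (heard (w * wave_len) (H (time w t) v)) => [x'|].
      by rewrite (value_in_Some e) in hn.
    rewrite timeS in e'; have [av _ [u [avu au ux]]] := heard_learn tP (leqnn _) e e'.
    by rewrite -act_inE; split=> //; exists u, x; rewrite -act_inE.
  rewrite /value_in /value e'; case: ifP => // st [<-]; left; split=> //.
  by apply: init_val st; apply: in_phase.
- by move=> t v tP st; rewrite /value_in /value; case: (heard _ _) => //; rewrite st.
- move=> t u v tP; rewrite -!act_inE => av au avu ou.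
  case ev: (value_in w t v) => [y|].
    case e: (heard (w * wave_len) (H (time w t) v)) => [x|].
      by rewrite (@value_in_Some _ t.+1 _ x) // timeS; apply: heard_stays e; apply: time_geq.
    rewrite /value_in /value; case: (heard _ (H (time w t.+1) v)) => //.
    move: ev; rewrite /value_in /value e; case: ifP => // st _.
    by rewrite (leq_trans st) // leq_div2r.
  have := ok t v tP; rewrite /fails av ev /=.
  rewrite (_ : [exists _, _] = true) /=; last by apply/existsP; exists u; rewrite avu au ou.
  case e: (heard _ _) => [x|//] _.
  by rewrite (value_in_Some e).
Qed.

(** * Induction on the levels *)

Section Levels.
Variable D : nat.
Hypotheses (adj_sym : symmetric adj) (connected : forall u v, within adj D u v).

Definition hop_level i : rel 'I_n := hop adj (act_level i) nsteps.

Lemma hop_level_within1 i u v : within adj 1 u v -> hop_level i u v.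
Proof.
rewrite /hop_level /hop => uv.
have /orP [/eqP <-|/existsP [w /andP [/eqP <- auv]]] := uv.
  by apply: (@spread_leq _ _ _ 0); rewrite ?inE.
apply: (@spread_leq _ _ _ 1) => //.
by apply: (@spreadS _ _ _ 0 _ u); rewrite ?inE // adj_sym.
Qed.

Lemma hop_level_connected i u v : within (hop_level i) D u v.
Proof.
by apply: within_coarsen (@hop_level_within1 i) _; rewrite muln1; apply: connected.
Qed.

Definition covered i :=
  (forall u v, within adj (b ^ i) u v -> hop_level i u v) /\
  (forall j v, j < nwaves -> lam i j v <= radius i).

Definition hop_dist i u v := graph_dist (hop_level i) D u v.

Definition padded_at i v := [exists j : 'I_nwaves, [exists u, [forall (x | x != u),
  start_phase gap (draw (f u) (nrounds + (i * nwaves + j))) + hop_dist i u v + gap <=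
  start_phase gap (draw (f x) (nrounds + (i * nwaves + j))) + hop_dist i x v]]].

Lemma covered0 : covered 0.
Proof.
split=> [u v|j v _]; last by rewrite /lam /= leq0n.
by rewrite expn0; apply: hop_level_within1.
Qed.

Lemma radius_gt0 i : 0 < radius i.
Proof. by rewrite /radius expn_gt0 muln_gt0 muln_gt0 nwaves_gt0 nphases_gt0. Qed.

Lemma radiusS i : nphases * (1 + nwaves * (2 * radius i + 1)) <= radius i.+1.
Proof.
have h := radius_gt0 i; rewrite {2}/radius expnSr -/(radius i).
rewrite mulnCA [_ * nphases]mulnC mulnCA mulnA.
rewrite -mulnA leq_mul2l; apply/orP; right; have := nwaves_gt0; nia.
Qed.

Lemma nsteps_geq i : i <= q -> 1 + nwaves * (2 * radius i + 1) <= nsteps.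
Proof.
move=> iq; rewrite /nsteps leq_add2l leq_mul2l leq_add2r leq_mul2l; apply/orP; right.
by rewrite /radius leq_exp2l ?iq ?orbT //; have := nwaves_gt0; have := nphases_gt0; nia.
Qed.

Lemma act_level_lt i k v : act_level i k v -> k < 1 + nwaves * (2 * radius i + 1).
Proof.
case: k => // k; rewrite /act_level /active /= => /andP [h _].
rewrite add1n ltnS addn1 mulnC -ltn_divLR ?nwaves_gt0 //.
Qed.

Lemma act_level_cast i k j v y : j < nwaves -> k <= 2 * radius i -> lam i j v = y ->
  near y ((radius i - k) + (k - radius i)) -> act_level i (1 + (k * nwaves + j)) v.
Proof.
move=> jM kr <- h; rewrite /act_level /active add1n /=.
by rewrite divnMDl ?nwaves_gt0 // (divn_small jM) addn0 modnMDl (modn_small jM) kr.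
Qed.

Lemma start_of_lt w v : w < last_wave -> start_of w (inp v) (f v) < nphases.
Proof.
move=> wl; rewrite /start_of wl /start_phase /nphases addn1 ltnS leq_mul2l.
apply/orP; right; have lt := draw_lt (f v) (nrounds + w).
case: (posnP (draw (f v) (nrounds + w))) => [->|d0]; first by rewrite trunc_log0.
by rewrite -(@leq_exp2l 2) // (leq_trans (trunc_logP _ _)) // ltnW.
Qed.

(** By the end every start has passed, so a vertex holds one more than what it heard, or 0 if it
    heard nothing, which is how [label] decodes the history. *)
Lemma final_label i j v : i < q -> j < nwaves ->
  value_in (i * nwaves + j) (nphases * nsteps) v = Some (lam i.+1 j v).
Proof.
move=> iq jM; set w := _ + j.
have wl : w < last_wave.
  apply: leq_trans (_ : i.+1 * nwaves <= _); last by rewrite leq_mul2r iq orbT.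
  by rewrite mulSnr ltn_add2l.
have tE : time w (nphases * nsteps) = w.+1 * wave_len by rewrite /time mulSnr.
rewrite /value_in /value mulnK ?nsteps_gt0 // (ltnW (start_of_lt _ wl)) tE.
rewrite /lam /= /label -/w take_hist; last first.
  by rewrite leq_mul2r mulSnr -addnS leq_add2l jM orbT.
by case: (heard _ _) => [x|]; rewrite /incr wl.
Qed.

Lemma level_wave i j : j < nwaves -> (i * nwaves + j) %/ nwaves = i.
Proof. by move=> jM; rewrite divnMDl ?nwaves_gt0 // (divn_small jM) addn0. Qed.

Lemma last_wave_gt i j : i < q -> j < nwaves -> i * nwaves + j < last_wave.
Proof.
move=> iq jM; apply: leq_trans (_ : i.+1 * nwaves <= _).
  by rewrite mulSnr ltn_add2l.
by rewrite leq_mul2r iq orbT.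
Qed.

(** Take a wave with a root [c] isolated at [u]. By the invariant, distance [b ^ i.+1] is at most
    [b] hops of level [i], so [u] and [v] both hang from [c], and the cast along that labeling links
    them. *)
Lemma covered_step i : i < q -> covered i ->
  (forall w t v, w < last_wave -> t < nphases * nsteps -> ~~ fails w t v) ->
  (forall v, padded_at i v) -> covered i.+1.
Proof.
move=> iq [cov _] ok pad.
have run j (jM : j < nwaves) : wave_run adj (act_level i) nsteps nphases
    (fun v => start_of (i * nwaves + j) (inp v) (f v)) S 0 (value_in (i * nwaves + j)).
  have wl := last_wave_gt iq jM.
  have := wave_run_hist (fun t v => ok _ t v wl).
  by rewrite level_wave // /incr wl.
have lam_leq j v : j < nwaves -> lam i.+1 j v <= radius i.+1.
  move=> jM; have := run_label_leq nsteps_gt0 (run j jM) (fun=> erefl) erefl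
    (@act_level_lt i) (leqnn _) (final_label v iq jM).
  rewrite mulnK ?nsteps_gt0 // modnMl min0n addn0 => h.
  exact: leq_trans h (radiusS i).
split=> // u v uv; have /existsP [[j jM] /existsP [c /= /forall_inP iso]] := pad u.
have wl := last_wave_gt iq jM.
have cast x : within adj (b ^ i.+1) u x ->
    exists2 y, value_in (i * nwaves + j) (nphases * nsteps) x = Some y &
      chain adj (value_in (i * nwaves + j) (nphases * nsteps)) y x c.
  move=> ux; apply: (run_isolated nsteps_gt0 (run j jM) (fun=> erefl) erefl
    (@hop_level_connected i) (g := gap) (b := b) (v := u)).
  - by rewrite /gap; lia.
  - by move=> z; apply: start_of_lt.
  - by move=> z zc; have := iso z zc; rewrite /start_of wl.
  - by apply: within_coarsen cov _; rewrite -expnS.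
  - by apply: within_coarsen cov _; rewrite -expnS; apply: within_sym ux.
have [y ey cy] := cast u (within_refl _ _ _); have [y' ey' cy'] := cast v uv.
apply: (spread_cast (j := j) (r := radius i.+1) jM adj_sym _ _ _ _ cy cy').
- move=> k x z kr; rewrite final_label // => -[ez]; exact: act_level_cast.
- exact: nsteps_geq.
- by move: ey; rewrite final_label // => -[<-]; apply: lam_leq.
- by move: ey'; rewrite final_label // => -[<-]; apply: lam_leq.
Qed.

(** The source starts the last wave at phase 0, and one phase of level [q] already reaches every
    vertex; values are passed on unchanged, so all of them equal [m]. *)
Lemma broadcast_ok_of_no_failure : D <= b ^ q ->
  (forall w t v, w <= last_wave -> t < nphases * nsteps -> ~~ fails w t v) ->
  (forall i v, i < q -> padded_at i v) ->
  broadcast_ok adj s m r.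
Proof.
move=> hD ok pad.
have cov i : i <= q -> covered i.
  elim: i => [_|i IH iq]; first exact: covered0.
  apply: covered_step => //; first exact/IH/ltnW.
    by move=> w t v wl; apply: ok; apply: ltnW.
  by move=> v; apply: pad.
have [hop_all _] := cov q (leqnn _).
have := wave_run_hist (fun t v => ok last_wave t v (leqnn _)).
rewrite ltnn mulnK ?nwaves_gt0 // => run.
apply/forallP => v; rewrite /output /= -/f -/(inp v).
have start_s : start_of last_wave (inp s) (f s) = 0.
  by rewrite /start_of ltnn /inp /input eqxx.
have os : value_in last_wave (0 * nsteps) s.
  by apply: (run_inject run); rewrite ?start_s.
have sv : v \in spread adj (act_level q) nsteps [set s].
  by apply: (hop_all s v); apply: within_leq hD (connected _ _).
have := run_spread nsteps_gt0 run nphases_gt0 (leqnn _) os sv.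
rewrite mul0n add0n; case e: (value_in _ _ v) => [x|//] _.
have le1 : nsteps <= nphases * nsteps by rewrite leq_pmull // nphases_gt0.
have e' := run_stays run le1 (leqnn _) e.
have xm : m = x.
  apply: (run_value_ind run (Q := fun z => m = z) _ _ (leqnn _) e') => // z ->.
  by rewrite /incr ltnn.
move: e'; rewrite /value_in mulnK ?nsteps_gt0 // -xm.
rewrite /time -/wave_len -mulSnr => e2.
have -> : value last_wave nphases (inp v) (f v) (hist adj s m r nrounds v) = Some m by exact: e2.
by [].
Qed.
End Levels.
End Execution.
End Algorithm.

(** * Failure probability *)

Section Probability.
Variables (L b q reps n : nat) (adj : rel 'I_n) (s : 'I_n) (m D : nat).
Hypotheses (L_gt0 : 0 < L) (reps_gt0 : 0 < reps) (n_gt0 : 0 < n) (n_small : 4 * n <= 2 ^ L).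

Local Notation A := (broadcast_algorithm L b q reps).
Local Notation K := (ndraws L b q reps).
Local Notation W := (wave_len L b q reps).
Local Notation R := (nrounds L b q reps).
Local Notation M := (nwaves L).
Local Notation Omega := {ffun 'I_K -> {ffun 'I_n -> 'I_(2 ^ L)}}.

(** [Omega] transposes the tapes: one coordinate holds the same draw of all vertices, so a slot or
    the starts of a wave can be resampled at once. *)
Definition tapes_of (o : Omega) : tapes A n := [ffun v => encode [ffun i => o i v]].

Lemma decode_tapes_of o v : decode (tapes_of o v) = [ffun i => o i v].
Proof. by rewrite ffunE encodeK. Qed.

Lemma draw_tapes_of o v (i : 'I_K) : draw (decode (tapes_of o v)) i = o i v.
Proof. by rewrite /draw valK decode_tapes_of ffunE. Qed.

Lemma card_tapes_of (Q : pred (tapes A n)) :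
  #|[set r | Q r]| = #|[set o | Q (tapes_of o)]|.
Proof.
pose g (r : tapes A n) : Omega := [ffun i => [ffun v => decode (r v) i]].
have gK : cancel g tapes_of.
  move=> r; apply/ffunP => v; rewrite ffunE -[RHS]decodeK; congr encode.
  by apply/ffunP => i; rewrite !ffunE.
have Kg : cancel tapes_of g.
  by move=> o; apply/ffunP => i; apply/ffunP => v; rewrite 2!ffunE decode_tapes_of ffunE.
rewrite -(card_imset _ (can_inj gK)); apply: eq_card => o; rewrite inE.
apply/imsetP/idP => [[r] |Qo]; first by rewrite inE => Qr ->; rewrite gK.
by exists (tapes_of o); rewrite ?inE // Kg.
Qed.

(** What the history before slot [t] depends on: the coins of earlier slots and the starts of the
    waves begun before [t]. *)
Definition agree t (o o' : Omega) :=
  (forall i : 'I_K, i < t -> o i = o' i) /\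
  (forall i : 'I_K, R <= i -> (i - R) * W < t -> o i = o' i).

Lemma draw_agree (o o' : Omega) t :
  (forall i : 'I_K, i = t :> nat -> o i = o' i) -> forall v,
  draw (decode (tapes_of o v)) t = draw (decode (tapes_of o' v)) t.
Proof.
move=> h v; have [tK|Kt] := ltnP t K; last by rewrite /draw insubF // ltnNge Kt.
by rewrite -[t]/(val (Ordinal tK)) !draw_tapes_of h.
Qed.

Lemma start_agree (o o' : Omega) w inp :
  (forall i : 'I_K, R <= i -> i - R = w -> o i = o' i) -> forall v,
  start_of w inp (decode (tapes_of o v)) = start_of w inp (decode (tapes_of o' v)).
Proof.
move=> h v; rewrite /start_of; case: ifP => // _; congr start_phase.
by apply: draw_agree => i e; apply: h; rewrite e ?leq_addr // addKn.
Qed.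

Lemma hist_agree t (o o' : Omega) : agree t o o' ->
  hist adj s m (tapes_of o) t = hist adj s m (tapes_of o') t.
Proof.
elim: t => [//|t IH] [h1 h2].
have ag : agree t o o'.
  by split=> i => [lt|Ri lt]; [apply: h1|apply: h2] => //; apply: ltnW.
have {IH} eh := IH ag; apply: functional_extensionality => v /=; rewrite eh.
set h := hist _ _ _ _ t; have sz u : size (h u) = t by rewrite /h size_hist.
have ea : act_of s m (tapes_of o) h = act_of s m (tapes_of o') h.
  apply: functional_extensionality => u; rewrite /act_of /= sz /action_at /value.
  rewrite (start_agree (o' := o')); last first.
    by move=> i Ri e; apply: h2 => //; rewrite e ltnS leq_trunc_div.
  by rewrite (draw_agree (o' := o')) // => i e; apply: h1; rewrite e.
by rewrite /obs ea.
Qed.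

Lemma act_in_agree o o' w t v : agree (time L b q reps w t) o o' ->
  act_in adj s m (tapes_of o) w t v = act_in adj s m (tapes_of o') w t v.
Proof. by move=> /hist_agree e; rewrite /act_in e. Qed.

Lemma value_in_agree o o' w t v : agree (time L b q reps w t) o o' ->
  (forall i : 'I_K, R <= i -> i - R = w -> o i = o' i) ->
  value_in adj s m (tapes_of o) w t v = value_in adj s m (tapes_of o') w t v.
Proof.
by move=> /hist_agree e h; rewrite /value_in /value e (start_agree _ h).
Qed.

Lemma hop_dist_agree o o' i u v : agree (i * M * W) o o' ->
  hop_dist adj s m (tapes_of o) D i u v = hop_dist adj s m (tapes_of o') D i u v.
Proof.
move=> /hist_agree e; rewrite /hop_dist /hop_level.
suff -> : act_level adj s m (tapes_of o) i = act_level adj s m (tapes_of o') i by [].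
by apply: functional_extensionality => k; rewrite /act_level /lam e.
Qed.

Definition informers o w t v := [set u | [&& adj v u,
  act_in adj s m (tapes_of o) w t u & value_in adj s m (tapes_of o) w t u]].

Lemma time_lt w t : w <= last_wave L q -> t < nphases L b * nsteps L b q ->
  forall c, c < nslots L reps -> time L b q reps w t + c < R.
Proof.
move=> wl tP c cD; apply: leq_trans (_ : w.+1 * W <= _); last by rewrite leq_mul2r ltnS wl orbT.
rewrite /time -addnA [in X in _ <= X]mulSnr ltn_add2l.
apply: leq_trans (_ : t.+1 * nslots L reps <= _); first by rewrite mulSnr ltn_add2l.
by rewrite leq_mul2r tP orbT.
Qed.

Lemma slot_lt (i : 'I_L.+1) (k : 'I_reps) : k * L.+1 + i < nslots L reps.
Proof.
apply: leq_trans (_ : k.+1 * L.+1 <= _); first by rewrite mulSnr ltn_add2l.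
by rewrite leq_mul2r ltn_ord orbT.
Qed.

(** The informers of [v] are determined before the block. A failure means that each of the [reps]
    slots of their decay kind lacks a lone transmitter, and these slots have independent coins. *)
Lemma card_fails w t v : w <= last_wave L q -> t < nphases L b * nsteps L b q ->
  8 ^ reps * #|[set o | fails adj s m (tapes_of o) w t v]| <=
  L.+1 * (7 ^ reps * #|Omega|).
Proof.
move=> wl tP; have slotR := time_lt wl tP.
set t0 := time L b q reps w t in slotR.
have slotK (i : 'I_L.+1) (k : 'I_reps) : t0 + (k * L.+1 + i) < K.
  by apply: leq_trans (slotR _ (slot_lt i k)) _; rewrite leq_addr.
pose e i k : 'I_K := Ordinal (slotK i k).
(* The right kind is itself random. Fixing [i] makes the slots fixed coordinates; the union over [i]
   costs the factor [L.+1]. *)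
pose bad i (k : 'I_reps) o : {set {ffun 'I_n -> 'I_(2 ^ L)}} :=
  if (informers o w t v != set0) && (decay_kind (informers o w t v) == i :> nat)
  then [set x | ~~ lone (informers o w t v) x] else set0.
have informersE i k o c : informers (upd o (e i k) c) w t v = informers o w t v.
  have ag : agree t0 (upd o (e i k) c) o.
    split=> [j lt|j Rj _]; rewrite updE; case: eqP => // ej.
      by move: lt; rewrite ej /= ltnNge leq_addr.
    by move: Rj; rewrite ej /= leqNgt slotR // slot_lt.
  apply/setP => u; rewrite !inE (act_in_agree _ ag) (value_in_agree _ ag) //.
  move=> j Rj _; rewrite updE; case: eqP => // ej.
  by move: Rj; rewrite ej /= leqNgt slotR // slot_lt.
have small o : 4 * #|informers o w t v| <= 2 ^ L.
  by apply: leq_trans n_small; rewrite leq_mul2l /= (leq_trans (max_card _)) ?card_ord.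
have bound (i : 'I_L.+1) : 8 ^ reps *
    #|[set o : Omega | [forall k, o (e i k) \in bad i k o]]| <= 7 ^ reps * #|Omega|.
  apply: card_resample_family.
  - move=> k k' [] /= /eqP; rewrite eqn_add2l eqn_add2r eqn_pmul2r // => /eqP.
    exact: val_inj.
  - by move=> k k' o c; rewrite /bad informersE.
  - move=> k o; rewrite /bad; case: ifP => [/andP [ne _]|_]; last by rewrite cards0 muln0.
    by apply: card_not_lone; rewrite ?card_gt0.
apply: leq_trans (_ : 8 ^ reps * \sum_(i < L.+1)
   #|[set o : Omega | [forall k, o (e i k) \in bad i k o]]| <= _); last first.
  rewrite big_distrr /= -[X in _ <= X * _](card_ord L.+1) -sum1_card big_distrl /=.
  by apply: leq_sum => i _; rewrite mul1n.
rewrite leq_mul2l; apply/orP; right; apply: leq_trans (card_exists _).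
apply: subset_leq_card; apply/subsetP => o; rewrite !inE.
rewrite /fails => /and4P [av nv /existsP [u hu] nh].
have ne : informers o w t v != set0 by apply/set0Pn; exists u; rewrite inE.
have [kL _ _] := decay_kind_bounds (L := L) (S := informers o w t v)
  (eq_ind_r is_true ne (card_gt0 _)) (small o).
have kL' : decay_kind (informers o w t v) < L.+1 by [].
apply/existsP; exists (Ordinal kL'); apply/forallP => k.
rewrite /bad ne eqxx /= inE; apply: contra nh => /eqP lo.
apply: (heard_lone reps_gt0 tP (slot_lt (Ordinal kL') k) av nv).
rewrite -[RHS]lo; apply: eq_card => x; rewrite !inE; congr (_ && _).
rewrite -/t0 -[t0 + _]/(val (e (Ordinal kL') k)) draw_tapes_of; congr below_kind.
(* Blocks begin at multiples of [L.+1], so the offset [i] is the kind of the slot. *)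
rewrite /= /t0 /time /wave_len /nslots !mulnA -mulnDl modnMDl.
by rewrite modnMDl modn_small.
Qed.

(** Hop distances of level [i] are settled before its first wave begins, hence independent of the
    starts in its [M] waves, each of which fails to pad with probability at most 3/4. *)
Lemma card_not_padded_at i v : i < q ->
  4 ^ M * #|[set o | ~~ padded_at adj s m (tapes_of o) D i v]| <= 3 ^ M * #|Omega|.
Proof.
move=> iq; have drawK (j : 'I_M) : R + (i * M + j) < K.
  by rewrite ltn_add2l last_wave_gt.
pose e j : 'I_K := Ordinal (drawK j).
pose d o u := hop_dist adj s m (tapes_of o) D i u v.
pose bad (j : 'I_M) o : {set {ffun 'I_n -> 'I_(2 ^ L)}} :=
  [set x | ~~ padded (gap b) x (d o)].
have iR : i * M * W <= R by rewrite leq_mul2r (leq_trans _ (leqnSn _)) ?leq_mul2r ?(ltnW iq) ?orbT.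
have dE j o c : d (upd o (e j) c) = d o.
  apply: functional_extensionality => u; apply: hop_dist_agree; split=> k.
    move=> lt; rewrite updE; case: eqP => // ek; move: (leq_trans lt iR).
    by rewrite ek /= ltnNge leq_addr.
  move=> Rk lt; rewrite updE; case: eqP => // ek; move: lt.
  by rewrite ek /= addKn ltnNge leq_mul2r leq_addr orbT.
apply: leq_trans (card_resample_family (e := e) (bad := bad) (a := 3) (d := 4) _ _ _).
- rewrite leq_mul2l; apply/orP; right; apply: subset_leq_card; apply/subsetP => o.
  rewrite !inE => np; apply/forallP => j; rewrite inE; apply: contra np.
  move=> /existsP [u /forallP h]; apply/existsP; exists j; apply/existsP; exists u.
  apply/forallP => x; have := h x.
  by rewrite -[R + _]/(val (e j)) !draw_tapes_of.
- by move=> j j' [] /eqP; rewrite !eqn_add2l => /eqP; apply: val_inj.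
- by move=> j j' o c; rewrite /bad dE.
- by move=> j o; apply: card_not_padded; rewrite ?card_ord // /gap addn1.
Qed.

(** Union bound: decay failures and missing paddings each contribute at most [1 / (2 * n)]. *)
Lemma card_failures : symmetric adj -> (forall u v, within adj D u v) -> D <= b ^ q ->
  2 * n * ((last_wave L q).+1 * (nphases L b * nsteps L b q) * n) * L.+1 * 7 ^ reps
    <= 8 ^ reps ->
  2 * n * (q * n) * 3 ^ M <= 4 ^ M ->
  n * #|[set r : tapes A n | ~~ broadcast_ok adj s m r]| <= #|[set: tapes A n]|.
Proof.
move=> adj_sym conn hD hreps hM.
pose T := nphases L b * nsteps L b q.
pose F := [set o : Omega | [exists p : 'I_(last_wave L q).+1 * 'I_T * 'I_n,
  fails adj s m (tapes_of o) p.1.1 p.1.2 p.2]].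
pose G := [set o : Omega | [exists p : 'I_q * 'I_n,
  ~~ padded_at adj s m (tapes_of o) D p.1 p.2]].
have -> : #|[set: tapes A n]| = #|Omega|.
  by have := card_tapes_of xpredT; rewrite !cardsE => ->; apply: eq_card.
rewrite card_tapes_of.
have sub : #|[set o | ~~ broadcast_ok adj s m (tapes_of o)]| <= #|F| + #|G|.
  apply: leq_trans (leq_card_setU F G).1; apply: subset_leq_card; apply/subsetP => o.
  rewrite in_setU inE; apply: contraR; rewrite negb_or !inE.
  rewrite !negb_exists => /andP [/forallP nf /forallP np].
  apply: (broadcast_ok_of_no_failure L_gt0 reps_gt0 adj_sym conn hD).
    move=> w t v wl tT.
    exact: (nf (Ordinal (wl : w < (last_wave L q).+1), Ordinal (tT : t < T), v)).
  by move=> i v iq; have := np (Ordinal iq, v); rewrite negbK.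
have hF : 2 * n * #|F| <= #|Omega|.
  have F1 : 8 ^ reps * #|F| <= (last_wave L q).+1 * T * n * (L.+1 * (7 ^ reps * #|Omega|)).
    apply: leq_trans (leq_mul (leqnn _) (card_exists _)) _.
    rewrite big_distrr /= -[in X in _ <= X](card_ord (last_wave L q).+1).
    rewrite -[X in _ <= _ * X * _ * _](card_ord T) -[X in _ <= _ * X * _](card_ord n).
    rewrite -!card_prod -sum1_card big_distrl /=; apply: leq_sum => -[[w t] v] _ /=.
    by rewrite mul1n card_fails // -ltnS.
  have e8 : 0 < 8 ^ reps by rewrite expn_gt0.
  rewrite -(leq_pmul2l e8); apply: leq_trans (leq_mul hreps (leqnn #|Omega|)).
  move: F1 (leqnn (2 * n)) => /(fun a b => leq_mul b a) h /h.
  by rewrite -/T; congr (_ <= _); lia.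
have hG : 2 * n * #|G| <= #|Omega|.
  have G1 : 4 ^ M * #|G| <= q * n * (3 ^ M * #|Omega|).
    apply: leq_trans (leq_mul (leqnn _) (card_exists _)) _.
    rewrite big_distrr /= -[in X in _ <= X * _ * _](card_ord q).
    rewrite -[X in _ <= _ * X * _](card_ord n) -!card_prod -sum1_card big_distrl /=.
    by apply: leq_sum => -[i v] _ /=; rewrite mul1n card_not_padded_at.
  have e4 : 0 < 4 ^ M by rewrite expn_gt0.
  rewrite -(leq_pmul2l e4); apply: leq_trans (leq_mul hM (leqnn #|Omega|)).
  move: G1 (leqnn (2 * n)) => /(fun a b => leq_mul b a) h /h.
  by congr (_ <= _); lia.
have h := leq_mul (leqnn (2 * n)) sub; move: h; rewrite mulnDr => h.
rewrite -(@leq_pmul2l 2) // mulnA; apply: leq_trans h _.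
by rewrite [X in _ <= X]mul2n -addnn leq_add.
Qed.

End Probability.

(** * Energy *)

Section Energy.
Variables (L b q reps n : nat) (adj : rel 'I_n) (s : 'I_n) (m : nat).
Hypotheses (L_gt0 : 0 < L) (reps_gt0 : 0 < reps).
Variable r : tapes (broadcast_algorithm L b q reps) n.

Local Notation M := (nwaves L).
Local Notation N := (nsteps L b q).
Local Notation W := (wave_len L b q reps).

(* The six microsteps of one cast in which a vertex with label [l] is active. *)
Definition cast_step rad l x := if x < 3 then rad + x - l.+1 else rad + l + (x - 3) - 1.

Lemma cast_step_onto rad l k : k <= 2 * rad -> near l ((rad - k) + (k - rad)) ->
  exists x : 'I_6, cast_step rad l x = k.
Proof.
rewrite /near /cast_step => k2 /andP [h1 h2].
have [kr|kr] := leqP k rad.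
  have x6 : k + l.+1 - rad < 6 by lia.
  by exists (Ordinal x6); rewrite /= ifT; lia.
have x6 : 3 + (k + 1 - rad - l) < 6 by lia.
by exists (Ordinal x6) => /=; lia.
Qed.

(** An active slot is determined by its wave, its phase, a microstep that is either microstep 0
    ([None]) or one of six in some cast, and its place in the block. *)
Lemma energy_leq v : energy_of adj s m r v <=
  (last_wave L q).+1 * nphases L b * (1 + M * 6) * nslots L reps.
Proof.
pose lb i j := lam adj s m r i j v.
pose step (i : nat) (o : option ('I_M * 'I_6)) :=
  if o is Some (j, x) then 1 + (cast_step (radius L b i) (lb i j) x * M + j) else 0.
pose code (p : 'I_(last_wave L q).+1 * 'I_(nphases L b) * option ('I_M * 'I_6) *
    'I_(nslots L reps)) : option 'I_(nrounds L b q reps) :=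
  insub (time L b q reps p.1.1.1 (p.1.1.2 * N + step (p.1.1.1 %/ M) p.1.2) + p.2).
have -> : (last_wave L q).+1 * nphases L b * (1 + M * 6) * nslots L reps =
    #|[set: 'I_(last_wave L q).+1 * 'I_(nphases L b) * option ('I_M * 'I_6) *
    'I_(nslots L reps)]|.
  by rewrite cardsT !card_prod card_option card_prod !card_ord.
apply: leq_trans (leq_imset_card code _).
rewrite /energy_of -(card_imset _ Some_inj); apply: subset_leq_card.
apply/subsetP => _ /imsetP [t + ->]; rewrite inE => at_.
have W0 : 0 < W by apply: wave_len_gt0.
have D0 : 0 < nslots L reps by apply: nslots_gt0.
have wl : t %/ W < (last_wave L q).+1 by rewrite ltn_divLR.
pose w := t %/ W; pose k := (t %% W) %/ nslots L reps; pose c := (t %% W) %% nslots L reps.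
have kT : k < nphases L b * N by rewrite ltn_divLR // ltn_pmod.
have cD : c < nslots L reps by rewrite ltn_pmod.
have tE : t = time L b q reps w k + c :> nat.
  by rewrite /time -addnA -divn_eq -divn_eq.
have {at_} av : act_in adj s m r w k v.
  move: at_; rewrite tE act_of_hist // /action_at -/(act_in adj s m r w k v).
  by case: (act_in _ _ _ _ _ _ _).
have pP : k %/ N < nphases L b by rewrite ltn_divLR.
have [o eo] : exists o, step (w %/ M) o = k %% N.
  move: av; rewrite act_inE // /act_level /active; case: (k %% N) => [|k'] /=.
    by exists None.
  case/andP => h1 h2; have [x ex] := cast_step_onto h1 h2.
  have M0 : 0 < M by apply: nwaves_gt0.
  pose j : 'I_M := Ordinal (ltn_pmod k' M0).
  exists (Some (j, x)); rewrite /step /lb [j : nat]/= ex.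
  by rewrite add1n -divn_eq.
apply/imsetP; exists (Ordinal wl, Ordinal pP, o, Ordinal cD) => //.
rewrite /code /= eo -divn_eq -tE; case: insubP => [u _ eu|]; last by rewrite ltn_ord.
by congr Some; apply: val_inj.
Qed.
End Energy.

(** * Choice of the constants *)

(* From one level to the next the radius grows by at most [Q * b], and [b = Q ^ a]
   turns the loss [Q ^ q] into about [D ^ (1 / a)]. The union bound has at most
   [2 ^ ((18 + 8 * a) * L)] terms, and [2 * 7 ^ 6 <= 8 ^ 6]. *)
Definition par_L n := (trunc_log 2 n).+3.
Definition par_Q n := 192 * par_L n ^ 2.
Definition par_b a n := par_Q n ^ a.
Definition par_q a n D := up_log (par_b a n) D.
Definition par_reps a n := 6 * ((18 + 8 * a) * par_L n).
Definition par_c a := 12 * (18 + 8 * a).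

Section Tuning.
Variable n : nat.
Hypothesis n_gt1 : 1 < n.

Let L := par_L n.
Let Q := par_Q n.

Lemma par_L_geq4 : 4 <= L.
Proof. by rewrite !ltnS; apply: trunc_log_max. Qed.

Lemma par_L_small : 4 * n <= 2 ^ L.
Proof.
rewrite /L /par_L 2!expnS mulnA leq_mul2l /=.
by apply: ltnW; apply: trunc_log_ltn.
Qed.

Lemma par_Q_gt1 : 1 < Q.
Proof. by rewrite /Q /par_Q -/L; have := par_L_geq4; nia. Qed.

Variables a D : nat.
Hypotheses (a_gt0 : 0 < a) (D_gt0 : 0 < D) (D_le : D <= n).

Let b := par_b a n.
Let q := par_q a n D.
Let reps := par_reps a n.
Let X := (Q * b) ^ q.-1.

Lemma par_Q_leq_b : Q <= b.
Proof. by rewrite -[b]/(Q ^ a) -[X in X <= _]expn1 leq_exp2l ?par_Q_gt1. Qed.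

Lemma par_b_gt1 : 1 < b.
Proof. exact: leq_trans par_Q_gt1 par_Q_leq_b. Qed.

Lemma par_q_cover : D <= b ^ q.
Proof. exact: up_logP par_b_gt1. Qed.

Lemma par_q_pred : b ^ q.-1 <= D.
Proof.
have [D1|D1] := leqP D 1; last exact/ltnW/up_log_gtn/D1/par_b_gt1.
have -> : q = 0 by apply/eqP; rewrite up_log_eq0 D1 orbT.
by [].
Qed.

Lemma par_q_leq : q <= L.
Proof.
apply: up_log_min par_b_gt1 _; apply: leq_trans D_le _.
apply: leq_trans (_ : 2 ^ L <= _); last by rewrite leq_exp2r ?par_b_gt1.
by have := par_L_small; lia.
Qed.

Lemma par_X_gt0 : 0 < X.
Proof. by rewrite expn_gt0 muln_gt0 (ltnW par_Q_gt1) (ltnW par_b_gt1). Qed.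

(** As [Q ^ a = b], the power [(Q * b) ^ a] is [b ^ a.+1], while [b ^ q.-1 <= D]. So [X] is at most
    [D] to the power [1 + 1 / a]. *)
Lemma par_X_leq : X ^ a <= D ^ a.+1.
Proof.
have -> : X ^ a = (b ^ q.-1) ^ a.+1.
  by rewrite /X ![(_ ^ q.-1) ^ _]expnAC expnMn -[Q ^ a]/b -expnS.
by rewrite leq_exp2r // par_q_pred.
Qed.

Lemma par_X_square : X <= n ^ 2.
Proof.
apply: leq_trans (_ : (b ^ q.-1) ^ 2 <= _); last first.
  by rewrite leq_exp2r // (leq_trans par_q_pred).
rewrite expnAC /X; case: (q.-1) => // k.
by rewrite leq_exp2r // [b ^ 2]expnS expn1 leq_mul2r par_Q_leq_b orbT.
Qed.

Lemma nphases_leq : nphases L b <= 4 * (b * L).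
Proof. by rewrite /nphases /gap; have := par_b_gt1; have := par_L_geq4; nia. Qed.

Lemma radius_leq : radius L b q <= Q * b * X.
Proof.
(* The constant of [par_Q] is 192 = 4 * 12 * 4, from this product, [nwaves] and [nphases_leq]. *)
have h : 4 * nwaves L * nphases L b <= Q * b.
  apply: leq_trans (leq_mul (leqnn _) nphases_leq) _.
  by rewrite /Q /par_Q -/L /nwaves; nia.
have Qb0 : 0 < Q * b by rewrite muln_gt0 (ltnW par_Q_gt1) (ltnW par_b_gt1).
rewrite /radius /X; case: (q) => [|k]; first by rewrite expn0 muln1.
by rewrite -expnS leq_exp2r.
Qed.

Lemma last_wave_leq : (last_wave L q).+1 <= 13 * L ^ 2.
Proof. by rewrite /last_wave /nwaves; have := par_q_leq; have := par_L_geq4; nia. Qed.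

Lemma microsteps_leq :
  (last_wave L q).+1 * (nphases L b * nsteps L b q) <= Q ^ 3 * b ^ 2 * X.
Proof.
have hN : nsteps L b q <= 48 * L * (Q * b * X).
  rewrite /nsteps; have := radius_leq; have := par_L_geq4; have := par_X_gt0.
  have := par_Q_gt1; have := par_b_gt1; rewrite /nwaves.
  have : 0 < radius L b q by apply: radius_gt0; have := par_L_geq4; lia.
  move: (radius _ _ _) => R R0 b1 Q1 X0 L4 R1.
  apply: leq_trans (_ : 48 * L * R <= _); first nia.
  by rewrite leq_mul2l R1 orbT.
apply: leq_trans (leq_mul last_wave_leq (leq_mul nphases_leq hN)) _.
have -> : 13 * L ^ 2 * (4 * (b * L) * (48 * L * (Q * b * X))) =
  2496 * L ^ 4 * (Q * b ^ 2 * X) by lia.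
have -> : Q ^ 3 * b ^ 2 * X = Q ^ 2 * (Q * b ^ 2 * X) by lia.
rewrite leq_mul2r; apply/orP; right.
by rewrite /Q /par_Q -/L expnMn -expnM leq_mul2r orbT.
Qed.

Lemma nslots_leq : nslots L reps <= par_c a * L ^ 2.
Proof.
rewrite /nslots /reps /par_reps /par_c -/L; have := par_L_geq4.
by move: (18 + 8 * a) => c; nia.
Qed.

Lemma rounds_leq : nrounds L b q reps <= par_c a * Q ^ (4 + 2 * a) * X.
Proof.
rewrite /nrounds /wave_len mulnA; apply: leq_trans (leq_mul microsteps_leq nslots_leq) _.
have -> : par_c a * Q ^ (4 + 2 * a) * X = Q ^ 3 * b ^ 2 * X * (par_c a * Q).
  by rewrite expnD [2 * a]mulnC expnM -[Q ^ a]/b; lia.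
rewrite !leq_mul2l; apply/orP; right; apply/orP; right.
by rewrite /Q /par_Q -/L leq_pmull.
Qed.

Lemma energy_bound_leq :
  (last_wave L q).+1 * nphases L b * (1 + nwaves L * 6) * nslots L reps <=
  par_c a * Q ^ (4 + 2 * a).
Proof.
have h : 1 + nwaves L * 6 <= 73 * L by rewrite /nwaves; have := par_L_geq4; lia.
apply: leq_trans (leq_mul (leq_mul (leq_mul last_wave_leq nphases_leq) h) nslots_leq) _.
have -> : 13 * L ^ 2 * (4 * (b * L)) * (73 * L) * (par_c a * L ^ 2) =
  par_c a * (b * (3796 * (L ^ 2) ^ 3)) by lia.
rewrite leq_mul2l; apply/orP; right.
apply: leq_trans (_ : b * Q ^ 3 <= _).
  by rewrite leq_mul2l /Q /par_Q -/L expnMn leq_mul2r; apply/orP; right; apply/orP; right.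
rewrite -[b]/(Q ^ a) -expnD leq_exp2l ?par_Q_gt1 //; lia.
Qed.

Lemma leq_L_exp : L.+1 <= 2 ^ L.
Proof. exact: ltn_expl. Qed.

Lemma reps_enough :
  2 * n * ((last_wave L q).+1 * (nphases L b * nsteps L b q) * n) * L.+1 * 7 ^ reps
    <= 8 ^ reps.
Proof.
have nL : n <= 2 ^ L by have := par_L_small; lia.
have QL : Q <= 2 ^ (4 * L).
  have L4 := par_L_geq4.
  have h : 2 ^ (4 * 2) <= 2 ^ (2 * L) by rewrite leq_exp2l //; lia.
  rewrite /Q /par_Q -/L (_ : 4 * L = 2 * L + L * 2); last by lia.
  rewrite expnD [2 ^ (L * 2)]expnM; apply: leq_mul; first by apply: leq_trans h.
  by rewrite leq_exp2r // ltnW // ltn_expl.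
(* In units of [L], the exponents are 1 for each of 2, [n], the second [n] and [L.+1], then 2 for
   [X], and [4 * (3 + 2 * a)] for [Q ^ 3 * b ^ 2]. *)
have main : 2 * n * ((last_wave L q).+1 * (nphases L b * nsteps L b q) * n) * L.+1
    <= 2 ^ ((18 + 8 * a) * L).
  apply: leq_trans (_ : 2 ^ L * 2 ^ L * (Q ^ 3 * b ^ 2 * (2 ^ L) ^ 2 * 2 ^ L) * 2 ^ L <= _).
    apply: leq_mul leq_L_exp; apply: leq_mul; first apply: leq_mul => //.
      by rewrite -[2]expn1 leq_exp2l //; have := par_L_geq4; lia.
    apply: leq_mul => //; apply: leq_trans microsteps_leq _; rewrite leq_mul2l.
    by rewrite (leq_trans par_X_square) ?orbT // leq_exp2r.
  have hb : Q ^ 3 * b ^ 2 <= 2 ^ (4 * L * (3 + a * 2)).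
    by rewrite -[b]/(Q ^ a) -expnM -expnD expnM leq_exp2r.
  apply: leq_trans (_ : 2 ^ L * 2 ^ L *
    (2 ^ (4 * L * (3 + a * 2)) * (2 ^ L) ^ 2 * 2 ^ L) * 2 ^ L <= _).
    by do 4![apply: leq_mul => //].
  by rewrite -expnM -!expnD leq_exp2l //; nia.
apply: leq_trans (leq_mul main (leqnn _)) _.
by rewrite /reps /par_reps -/L !(expnM _ 6) -expnMn leq_exp2r ?muln_gt0.
Qed.

Lemma waves_enough : 2 * n * (q * n) * 3 ^ nwaves L <= 4 ^ nwaves L.
Proof.
have nL : 2 * n <= 2 ^ L by have := par_L_small; lia.
have main : 2 * n * (q * n) <= 2 ^ (4 * L).
  apply: leq_trans (_ : 2 ^ L * (2 ^ L * 2 ^ L) <= _).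
    apply: leq_mul => //; apply: leq_mul; last by lia.
    by apply: leq_trans par_q_leq _; have := leq_L_exp; lia.
  by rewrite -!expnD leq_exp2l //; lia.
apply: leq_trans (leq_mul main (leqnn _)) _.
(* The constant 12 of [nwaves] is 3 * 4: three waves gain a factor 2 since [2 * 3 ^ 3 <= 4 ^ 3], and
   [2 ^ (4 * L)] is to be beaten. *)
have -> : nwaves L = 3 * (4 * L) by rewrite /nwaves; lia.
rewrite !(expnM _ 3) -expnMn leq_exp2r //.
Qed.
End Tuning.

(** * Real bounds and the theorem *)

Lemma INR_expn x k : INR (x ^ k)%N = (INR x ^ k)%R.
Proof. by elim: k => // k IH; rewrite expnS mult_INR IH. Qed.

Lemma INR_leq x y : (x <= y)%N -> (INR x <= INR y)%R.
Proof. by move=> /leP; apply: le_INR. Qed.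

Lemma ln_leq x y : (0 < x)%R -> (x <= y)%R -> (ln x <= ln y)%R.
Proof.
move=> x0 [xy|->]; last exact: Rle_refl.
by apply/Rlt_le/ln_increasing.
Qed.

Lemma ln2_geq : (/ 2 <= ln 2)%R.
Proof.
rewrite -[X in (X <= _)%R]ln_exp; apply: ln_leq; first exact: exp_pos.
have h := exp_le_3; have p := exp_pos (/ 2).
have e : exp 1 = (exp (/ 2) * exp (/ 2))%R by rewrite -exp_plus; congr exp; lra.
by nra.
Qed.

Lemma trunc_log_ln n : (0 < n)%N -> (INR (trunc_log 2 n) <= 2 * ln (INR n))%R.
Proof.
move=> n0; have := INR_leq (@trunc_logP 2 n isT n0); rewrite INR_expn => h.
have p2 : (0 < INR 2 ^ trunc_log 2 n)%R by apply: pow_lt; simpl; lra.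
have := ln_leq p2 h; rewrite ln_pow; last by simpl; lra.
have := ln2_geq; have := pos_INR (trunc_log 2 n); rewrite [INR 2]/=.
have -> : (1 + 1 = 2)%R by lra.
nra.
Qed.

(** Since [trunc_log 2 n >= 1], [par_L n] is at most four times this logarithm, hence at most
    [8 * ln n]; and 12288 = 192 * 8 ^ 2. *)
Lemma par_Q_ln n : (1 < n)%N -> (INR (par_Q n) <= 12288 * (ln (INR n)) ^ 2)%R.
Proof.
move=> n1; have h := trunc_log_ln (ltnW n1).
have t1 : (1 <= INR (trunc_log 2 n))%R.
  by rewrite -[1%R]/(INR 1); apply: INR_leq; apply: trunc_log_max.
have eL : INR (par_L n) = (INR (trunc_log 2 n) + 3)%R by rewrite /par_L !S_INR; lra.
have e192 : INR 192 = 192%R by rewrite INR_IZR_INZ.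
rewrite /par_Q mult_INR INR_expn eL e192.
nra.
Qed.

Lemma pow_Rpower_le x k y : (1 <= x)%R -> (INR k <= y)%R -> (x ^ k <= Rpower x y)%R.
Proof.
move=> x1 ky; rewrite -Rpower_pow; last lra.
by apply: Rle_Rpower.
Qed.

Lemma root_le X D a y : (0 < a)%N -> (1 <= D)%R -> (0 < X)%R ->
  (X ^ a <= D ^ a.+1)%R -> (/ INR a <= y)%R -> (X <= Rpower D (1 + y))%R.
Proof.
move=> a0 D1 X0 h hy; have ia : (0 < INR a)%R by apply: lt_0_INR; apply/ltP.
have -> : X = Rpower (X ^ a) (/ INR a).
  by rewrite -Rpower_pow // Rpower_mult Rinv_r ?Rpower_1 //; lra.
apply: Rle_trans (_ : Rpower (D ^ a.+1) (/ INR a) <= _)%R.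
  apply: Rle_Rpower_l; last by split=> //; apply: pow_lt.
  by apply/Rlt_le/Rinv_0_lt_compat.
rewrite -Rpower_pow; last lra.
rewrite Rpower_mult; apply: Rle_Rpower => //.
by rewrite S_INR Rmult_plus_distr_r Rinv_r; lra.
Qed.

(** Take [a] just above [/ eps]; then [4 + 2 * a <= 6 + 2 / eps], and [1 < / eps] absorbs the 6. *)
Lemma exponent_exists eps : (0 < eps < 1)%R ->
  exists a : nat, [/\ (0 < a)%N, (/ INR a <= eps)%R & (INR (4 + 2 * a) <= 8 / eps)%R].
Proof.
move=> [e0 e1]; have ie : (1 < / eps)%R by rewrite -Rinv_1; apply: Rinv_lt_contravar; lra.
have [h1 h2] := archimed (/ eps).
have z0 : (0 <= up (/ eps))%Z by apply: le_IZR; lra.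
have [a ea] := IZN _ z0; exists a.
have e : INR a = IZR (up (/ eps)) by rewrite INR_IZR_INZ ea.
split.
- by apply/ltP; apply: INR_lt; rewrite e /=; lra.
- rewrite e -[X in (_ <= X)%R]Rinv_inv; apply: Rinv_le_contravar; lra.
- rewrite plus_INR mult_INR e /=; rewrite /Rdiv; lra.
Qed.

Theorem theorem6 :
  exists K : R, (0 < K)%R /\
  forall eps : R, (0 < eps < 1)%R ->
  exists (A : nat -> nat -> algorithm) (C : R), (0 < C)%R /\
  forall (n D : nat), 2 <= n ->
  forall (adj : rel 'I_n), simple_graph adj -> has_diameter adj D ->
  (* time: O(D^{1+eps} log^{O(1/eps)} n) *)
  (INR (rounds (A n D)) <=
     C * Rpower (INR D) (1 + eps) * Rpower (ln (INR n)) (K / eps))%R /\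
  (* energy: O(log^{O(1/eps)} n), for every vertex and every random outcome *)
  (forall (s : 'I_n) (m : nat) (r : tapes (A n D) n) (v : 'I_n),
     INR (energy_of adj s m r v) <= C * Rpower (ln (INR n)) (K / eps))%R /\
  (* success with high probability, for every source and message *)
  (forall (s : 'I_n) (m : nat), fail_prob (A n D) adj s m <= / INR n)%R.
Proof.
(* The bound [Q ^ (4 + 2 * a)] is a power at most [8 / eps] of a multiple of [ln n] squared, whence
   16. *)
exists 16%R; split; first lra.
move=> eps heps; have [a [a0 ae a8]] := exponent_exists heps.
exists (fun n D => broadcast_algorithm (par_L n) (par_b a n) (par_q a n D) (par_reps a n)).
exists (INR (par_c a) * Rpower 12288 (8 / eps))%R.
have c0 : (0 < INR (par_c a))%R by apply: lt_0_INR; apply/ltP; rewrite muln_gt0.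
have C0 := Rmult_lt_0_compat _ _ c0 (exp_pos (8 / eps * ln 12288)).
split=> // n D n1 adj [adj_sym _] diam.
have n0 : (0 < n)%N := ltnW n1.
have D0 : (0 < D)%N.
  case: (D) diam => // -[h _].
  by have := h (Ordinal n0) (Ordinal n1).
have Dn := diameter_le diam; have [conn _] := diam.
have lnn : (0 < ln (INR n))%R.
  by rewrite -ln_1; apply: ln_increasing; [lra | rewrite -[1%R]/(INR 1); apply/lt_INR/ltP].
have L4 := par_L_geq4 n1; have L0 : (0 < par_L n)%N by apply: leq_trans L4.
have reps0 : (0 < par_reps a n)%N by rewrite !muln_gt0 L0.
pose Y := (Rpower 12288 (8 / eps) * Rpower (ln (INR n)) (16 / eps))%R.
have hY : (INR (par_Q n ^ (4 + 2 * a)) <= Y)%R.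
  rewrite INR_expn; apply: Rle_trans (pow_Rpower_le _ a8) _.
    by rewrite -[1%R]/(INR 1); apply: INR_leq; apply: ltnW; apply: par_Q_gt1.
  apply: Rle_trans (Rle_Rpower_l _ _ _ _ (conj _ (par_Q_ln n1))) _.
  - by apply/Rlt_le/Rdiv_lt_0_compat; lra.
  - by apply: lt_0_INR; apply/ltP; apply: ltnW; apply: par_Q_gt1.
  rewrite -Rpower_mult_distr; [|lra|exact: pow_lt].
  rewrite -[(ln (INR n) ^ 2)%R]Rpower_pow // Rpower_mult.
  apply: Req_le; congr (_ * Rpower _ _)%R; rewrite [INR 2]/=; field; lra.
have D1 : (1 <= INR D)%R by rewrite -[1%R]/(INR 1); apply: INR_leq.
have hc : (INR (par_c a * par_Q n ^ (4 + 2 * a)) <= INR (par_c a) * Y)%R.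
  by rewrite mult_INR; apply: Rmult_le_compat_l => //; lra.
have Y0 : (0 <= Y)%R by apply/Rlt_le/Rmult_lt_0_compat; apply: exp_pos.
split; [|split].
- apply: Rle_trans (INR_leq (rounds_leq n1 a0 D0 Dn)) _.
  have hX : (INR ((par_Q n * par_b a n) ^ (par_q a n D).-1) <= Rpower (INR D) (1 + eps))%R.
    apply: (root_le a0 D1 _ _ ae).
      by apply: lt_0_INR; apply/ltP; apply: par_X_gt0.
    by rewrite -!INR_expn; apply: INR_leq; apply: par_X_leq.
  rewrite mult_INR; apply: Rle_trans (Rmult_le_compat _ _ _ _ (pos_INR _) (pos_INR _) hc hX) _.
  by apply: Req_le; rewrite /Y; ring.
- move=> s m r v.
  apply: Rle_trans (INR_leq (energy_leq adj s m L0 reps0 r v)) _.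
  apply: Rle_trans (INR_leq (energy_bound_leq n1 a0 D0 Dn)) _.
  by apply: Rle_trans hc _; apply: Req_le; rewrite /Y; ring.
- move=> s m; rewrite /fail_prob.
  have h := card_failures s m L0 reps0 n0 (par_L_small n) adj_sym conn
    (par_q_cover n1 D a0) (reps_enough n1 a0 D0 Dn) (waves_enough n1 a0 D0 Dn).
  have in0 : (0 < INR n)%R by apply: lt_0_INR; apply/ltP.
  have iT : (0 < INR #|[set: tapes (broadcast_algorithm (par_L n) (par_b a n)
      (par_q a n D) (par_reps a n)) n]|)%R.
    apply: lt_0_INR; apply/ltP; rewrite cardsT card_ffun expn_gt0.
    by rewrite card_tuple card_bool expn_gt0.
  apply: (Rmult_le_reg_r _ _ _ iT); rewrite /Rdiv Rmult_assoc Rinv_l ?Rmult_1_r; last lra.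
  apply: (Rmult_le_reg_l _ _ _ in0); rewrite -Rmult_assoc Rinv_r ?Rmult_1_l; last lra.
  by rewrite -mult_INR; apply: INR_leq.
Qed.
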